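(* Assume the standing setting and hypotheses (H1), (H2), (H3) below, let $p\in[1,+\infty]$, and equip $X$ and $Y$ with $\|\cdot\|_p$. The following are equivalent: (i) the system (P) with state space $X$ is exp-ISS w.r.t. inputs in $\mathcal{U}$: there are $M,a>0$ and $\gamma\in\mathcal{K}_\infty$ with $\|\phi(t,x,u)\|_p\le Me^{-at}\|x\|_p+\gamma(\|u\|_{\mathcal{U}})$ for all $t\ge0$, $x\in X$, $u\in\mathcal{U}(x)$; (ii) the same estimate holds for all $t\ge0$, $x\in X$ and all $u\in\mathcal{U}(x)$ which are constant in time (i.e. $u(t,z)=u(0,z)$ for all $t\ge0$, $z\in\partial G$); (iii) the system (Q) with state space $Y$ is exp-ISS w.r.t. inputs in $\mathcal{V}$: there are $M,a>0$, $\gamma\in\mathcal{K}_\infty$ with $\|\phi_Y(t,y,v)\|_p\le Me^{-at}\|y\|_p+\gamma(\|v\|_{\mathcal{V}})$ for all $t\ge0$, $y\in Y$, $v\in\mathcal{V}$.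
   Context: Standing setting: $G\subset\mathbb{R}^n$ open and bounded; $CL=C^0(\mathbb{R}_+\times\overline G)\cap C^{1,2}((0,\infty)\times G)$; $x[t]:=x(t,\cdot)$. $L$: $(Lx)(t,z)=\partial_tx-\sum_{i,j=1}^na_{ij}(z)\partial_{z_i}\partial_{z_j}x-f(z,x,\nabla x)$, $a_{ij}\in C^0(\overline G)$, $f\in C^0(\overline G\times\mathbb{R}\times\mathbb{R}^n)$, uniformly parabolic ($\sum a_{ij}(z)\xi_i\xi_j\ge K|\xi|^2$, $K>0$). Problem (P): $Lx=0$ on $(0,\infty)\times G$, $x(0,\cdot)=x_0$ on $G$, $x=u$ on $\mathbb{R}_+\times\partial G$. $\mathcal{U}=\{u\in C^0(\mathbb{R}_+;C^0(\partial G)):u\text{ bounded}\}$, $\|u\|_{\mathcal{U}}=\sup_{t\ge0,z\in\partial G}|u(t,z)|$, ordered pointwise. $\phi(t,x_0,u)=x[t]$ denotes the unique classical solution of (P). (H1) There is a linear space $X\subseteq C^0(\overline G)$ containing all constant functions, and for each $x_0\in X$ a nonempty set $\mathcal{U}(x_0)\subseteq\{v\in\mathcal{U}:v(0,z)=x_0(z)\ \forall z\in\partial G\}$ containing every $v\in\mathcal{U}$ with $v(t,z)=x_0(z)$ for all $z\in\partial G$, $t\ge0$, such that for every $x_0\in X$, $u\in\mathcal{U}(x_0)$ problem (P) has a solution $x\in CL$ with $x[t]\in X$ for all $t\ge0$. (H2) For every bounded $W\subset\mathbb{R}$ there is $k>0$ with $f(z,w_1,\xi)-f(z,w_2,\xi)<k(w_1-w_2)$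 for all $w_1>w_2$ in $W$, $z\in G$, $\xi\in\mathbb{R}^n$; and $f$ is continuously differentiable w.r.t. $(w,\xi)$. (H3) For every $\delta>0$, $a\in\mathbb{R}$, $x\in X$ there is a continuous $k:\overline G\to[0,1]$ with $k=1$ on $\partial G$, $k(z)=0$ whenever $z\in G$ and $\inf_{s\in\partial G}|z-s|\ge\delta$, and $(1-k)x+ak\in X$. System (Q): $\partial_ty-\sum a_{ij}(z)\partial_{z_i}\partial_{z_j}y-f(z,y+v,\nabla y)=0$ on $(0,\infty)\times G$, $y=0$ on $\mathbb{R}_+\times\partial G$, with state space $Y=\{y\in X:y=0\text{ on }\partial G\}$ and inputs $\mathcal{V}=\{v\in C^0(\mathbb{R}_+\times\overline G):v\equiv k\text{ for some }k\in\mathbb{R}\}$, $\|v\|_{\mathcal{V}}=|k|$. Its solution is $\phi_Y(t,y,v)=\phi(t,y+v,v|_{\partial G})-v$. $\mathcal{K}_\infty$: continuous, strictly increasing, unbounded $\gamma:\mathbb{R}_+\to\mathbb{R}_+$ with $\gamma(0)=0$. *)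

(* Defs.v *)
From Stdlib Require Import Reals Lra ZArith List ClassicalEpsilon.
Open Scope R_scope.

(* Points of R^n are represented as functions nat -> R; only the
   coordinates i < n are ever looked at by the (pseudo)metric below.
   Openness / continuity w.r.t. this pseudometric forces all the
   relevant objects to depend only on the first n coordinates. *)
Definition Pt := nat -> R.

Definition sumR (n : nat) (F : nat -> R) : R :=
  fold_right (fun i acc => F i + acc) 0 (seq 0 n).

Definition dst (n : nat) (z w : Pt) : R :=
  sqrt (sumR n (fun i => (z i - w i) ^ 2)).

Definition upd (z : Pt) (i : nat) (h : R) : Pt :=
  fun k => if Nat.eq_dec k i then h else z k.

Definition gopen (n : nat) (G : Pt -> Prop) : Prop :=
  forall z, G z -> exists r, 0 < r /\ forall w, dst n z w < r -> G w.

Definition gbounded (n : nat) (G : Pt -> Prop) : Prop :=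
  exists B, forall z, G z -> dst n z (fun _ => 0) <= B.

Definition clos (n : nat) (G : Pt -> Prop) (z : Pt) : Prop :=
  forall eps, 0 < eps -> exists w, G w /\ dst n z w < eps.

Definition bdry (n : nat) (G : Pt -> Prop) (z : Pt) : Prop :=
  clos n G z /\ ~ G z.

Definition cont_on (n : nat) (S : Pt -> Prop) (g : Pt -> R) : Prop :=
  forall z, S z -> forall eps, 0 < eps -> exists d, 0 < d /\
    forall w, S w -> dst n z w < d -> Rabs (g w - g z) < eps.

Definition cont2_on (n : nat) (S : R -> Pt -> Prop) (x : R -> Pt -> R) : Prop :=
  forall t z, S t z -> forall eps, 0 < eps -> exists d, 0 < d /\
    forall s w, S s w -> Rmax (Rabs (s - t)) (dst n z w) < d ->
      Rabs (x s w - x t z) < eps.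

Definition cont_f (n : nat) (G : Pt -> Prop) (g : Pt -> R -> Pt -> R) : Prop :=
  forall z w xi, clos n G z -> forall eps, 0 < eps -> exists d, 0 < d /\
    forall z' w' xi', clos n G z' ->
      Rmax (dst n z z') (Rmax (Rabs (w' - w)) (dst n xi xi')) < d ->
      Rabs (g z' w' xi' - g z w xi) < eps.

(* supremum of a set of reals (0 if it has no least upper bound) *)
Definition Rsup (E : R -> Prop) : R :=
  match excluded_middle_informative (exists l, is_lub E l) with
  | left H => proj1_sig (constructive_indefinite_description _ H)
  | right _ => 0
  end.

(* a ^ b for a >= 0, b > 0, with 0 ^ b = 0 *)
Definition rpow (a b : R) : R :=
  if Rle_dec a 0 then 0 else Rpower a b.

(* Lebesgue ginteg over the open set G of a nonnegative continuous
   function g, as the supremum of lower sums over finite families of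
   distinct closed dyadic cubes (side 2^-k) contained in G. *)
Definition dyadic_cube (n k : nat) (m : list Z) (z : Pt) : Prop :=
  forall i, (i < n)%nat ->
    IZR (nth i m 0%Z) / 2 ^ k <= z i <= (IZR (nth i m 0%Z) + 1) / 2 ^ k.

Definition lower_sums (n : nat) (G : Pt -> Prop) (g : Pt -> R) (s : R) : Prop :=
  exists (k : nat) (L : list (list Z * R)),
    NoDup (map fst L) /\
    (forall m c, In (m, c) L ->
       length m = n /\ 0 <= c /\
       forall z, dyadic_cube n k m z -> G z /\ c <= g z) /\
    s = fold_right (fun mc acc => snd mc * (/ 2) ^ (k * n) + acc) 0 L.

Definition ginteg (n : nat) (G : Pt -> Prop) (g : Pt -> R) : R :=
  Rsup (lower_sums n G g).

Inductive pexp : Type := PFin (p : R) | PInf.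

Definition valid_p (p : pexp) : Prop :=
  match p with PFin q => 1 <= q | PInf => True end.

Definition normp (n : nat) (G : Pt -> Prop) (p : pexp) (x : Pt -> R) : R :=
  match p with
  | PFin q => rpow (ginteg n G (fun z => rpow (Rabs (x z)) q)) (/ q)
  | PInf => Rsup (fun r => r = 0 \/ exists z, G z /\ r = Rabs (x z))
  end.

(* the input space U: bounded elements of C^0(R_+; C^0(dG)) *)
Definition U_set (n : nat) (G : Pt -> Prop) (u : R -> Pt -> R) : Prop :=
  (forall t, 0 <= t -> cont_on n (bdry n G) (u t)) /\
  (forall t, 0 <= t -> forall eps, 0 < eps -> exists d, 0 < d /\
     forall s, 0 <= s -> Rabs (s - t) < d ->
       forall z, bdry n G z -> Rabs (u s z - u t z) < eps) /\
  (exists B, forall t z, 0 <= t -> bdry n G z -> Rabs (u t z) <= B).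

Definition normU (n : nat) (G : Pt -> Prop) (u : R -> Pt -> R) : R :=
  Rsup (fun r => r = 0 \/
          exists t z, 0 <= t /\ bdry n G z /\ r = Rabs (u t z)).

Definition K_inf (g : R -> R) : Prop :=
  g 0 = 0 /\
  (forall t, 0 <= t -> forall eps, 0 < eps -> exists d, 0 < d /\
     forall s, 0 <= s -> Rabs (s - t) < d -> Rabs (g s - g t) < eps) /\
  (forall s t, 0 <= s -> s < t -> g s < g t) /\
  (forall B, exists t, 0 <= t /\ B < g t).

Definition is_sol (n : nat) (G : Pt -> Prop) (A : nat -> nat -> Pt -> R)
  (f : Pt -> R -> Pt -> R) (x0 : Pt -> R) (u : R -> Pt -> R)
  (x : R -> Pt -> R) : Prop :=
  cont2_on n (fun t z => 0 <= t /\ clos n G z) x /\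
  (exists (dt : R -> Pt -> R) (D1 : nat -> R -> Pt -> R)
          (D2 : nat -> nat -> R -> Pt -> R),
    (forall t z, 0 < t -> G z ->
       derivable_pt_lim (fun s => x s z) t (dt t z)) /\
    (forall i t z, (i < n)%nat -> 0 < t -> G z ->
       derivable_pt_lim (fun h => x t (upd z i h)) (z i) (D1 i t z)) /\
    (forall i j t z, (i < n)%nat -> (j < n)%nat -> 0 < t -> G z ->
       derivable_pt_lim (fun h => D1 j t (upd z i h)) (z i) (D2 i j t z)) /\
    cont2_on n (fun t z => 0 < t /\ G z) dt /\
    (forall i, (i < n)%nat -> cont2_on n (fun t z => 0 < t /\ G z) (D1 i)) /\
    (forall i j, (i < n)%nat -> (j < n)%nat ->
       cont2_on n (fun t z => 0 < t /\ G z) (D2 i j)) /\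
    (forall t z, 0 < t -> G z ->
       dt t z - sumR n (fun i => sumR n (fun j => A i j z * D2 i j t z))
         - f z (x t z) (fun i => D1 i t z) = 0)) /\
  (forall z, G z -> x 0 z = x0 z) /\
  (forall t z, 0 <= t -> bdry n G z -> x t z = u t z).

(* Main.v *)
Require Import Defs.
From Stdlib Require Import Reals Lra ZArith List ClassicalEpsilon.
From Stdlib Require Import Lia Psatz Classical FunctionalExtensionality.
Open Scope R_scope.

(** The implication from (Q) to (P) rests on a comparison principle. If [|u| <= r] on the
    boundary and [b = r + eps], hypothesis (H3) yields initial states in [X] which lie above,
    respectively below, [x0], take the constant boundary values [b] and [- b], and stay within
    [|x0| + b] of these constants. The solutions they generate under constant inputs enclose
    the given one and are, up to the shift by [b] or [- b], trajectories of (Q); letting [eps]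
    tend to [0] gives the estimate. Passing between (P) and (Q) shifts functions by constants,
    which in the [p]-norm costs only a multiple of the constant since [G] is bounded. *)

(** The norms shape the estimates: [ginteg] is a supremum of lower sums over dyadic cubes, and only
    inequalities with a multiplicative constant [C] are derived for it. The loss is harmless,
    because [C] enters [M] and the gain but never the rate [a].

    The margin [eps] comes from a boundary layer. The bound [x0 <= r] holds on the boundary only,
    and [x0] may exceed [r] at points arbitrarily close to it; [r + eps] dominates [x0] on a whole
    layer, outside of which the weight [k] of (H3) vanishes. It is the continuity of the gain that
    removes [eps] afterwards.

    The comparison principle has to work with a matrix [A] that is not assumed symmetric and with
    derivatives given only as iterated partial derivatives. Continuity of the second derivatives
    makes the Hessian symmetric, so [A] may be replaced by its symmetric part; the sign of the trace
    of the product then follows by Schur complements, without diagonalisation. *)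

(** * Finite sums, the pseudometric and continuity on sets *)

Lemma sumR_0 (F : nat -> R) : sumR 0 F = 0.
Proof. reflexivity. Qed.

Lemma sumR_S (n : nat) (F : nat -> R) : sumR (S n) F = sumR n F + F n.
Proof.
  unfold sumR. rewrite seq_S, fold_right_app. simpl.
  generalize (seq 0 n). induction l as [|a l IH]; simpl; [lra|rewrite IH; lra].
Qed.

Lemma sumR_ext (n : nat) (F H : nat -> R) :
  (forall i, (i < n)%nat -> F i = H i) -> sumR n F = sumR n H.
Proof.
  induction n as [|n IH]; intros E; [reflexivity|].
  rewrite !sumR_S, IH, E; auto.
Qed.

Lemma sumR_le (n : nat) (F H : nat -> R) :
  (forall i, (i < n)%nat -> F i <= H i) -> sumR n F <= sumR n H.
Proof.
  induction n as [|n IH]; intros E; [rewrite !sumR_0; lra|].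
  rewrite !sumR_S. apply Rplus_le_compat; auto.
Qed.

Lemma sumR_plus (n : nat) (F H : nat -> R) :
  sumR n (fun i => F i + H i) = sumR n F + sumR n H.
Proof.
  induction n as [|n IH]; [rewrite !sumR_0; lra|].
  rewrite !sumR_S, IH; ring.
Qed.

Lemma sumR_scal (n : nat) (c : R) (F : nat -> R) :
  sumR n (fun i => c * F i) = c * sumR n F.
Proof.
  induction n as [|n IH]; [rewrite !sumR_0; lra|].
  rewrite !sumR_S, IH; ring.
Qed.

Lemma sumR_const (n : nat) (c : R) : sumR n (fun _ => c) = INR n * c.
Proof.
  induction n as [|n IH]; [rewrite sumR_0; simpl; lra|].
  rewrite sumR_S, IH, S_INR; ring.
Qed.

Lemma sumR_nonneg (n : nat) (F : nat -> R) :
  (forall i, (i < n)%nat -> 0 <= F i) -> 0 <= sumR n F.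
Proof.
  intros E. replace 0 with (sumR n (fun _ => 0)) by (rewrite sumR_const; ring).
  now apply sumR_le.
Qed.

Lemma sumR_term_le (n i : nat) (F : nat -> R) :
  (forall j, (j < n)%nat -> 0 <= F j) -> (i < n)%nat -> F i <= sumR n F.
Proof.
  induction n as [|n IH]; intros E Hi; [lia|].
  rewrite sumR_S. destruct (Nat.eq_dec i n) as [->|ne].
  - pose proof (sumR_nonneg n F (fun j Hj => E j (Nat.lt_lt_succ_r _ _ Hj))). lra.
  - pose proof (IH (fun j Hj => E j (Nat.lt_lt_succ_r _ _ Hj)) ltac:(lia)).
    pose proof (E n ltac:(lia)). lra.
Qed.

Lemma sumR_swap (n m : nat) (F : nat -> nat -> R) :
  sumR n (fun i => sumR m (fun j => F i j)) = sumR m (fun j => sumR n (fun i => F i j)).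
Proof.
  induction n as [|n IH].
  - rewrite sumR_0, (sumR_ext m _ (fun _ => 0)), sumR_const by reflexivity. ring.
  - rewrite sumR_S, IH, <- sumR_plus. apply sumR_ext. intros; now rewrite sumR_S.
Qed.

Lemma coord_le_dst (n i : nat) (z w : Pt) :
  (i < n)%nat -> Rabs (z i - w i) <= dst n z w.
Proof.
  intros Hi. unfold dst. rewrite <- sqrt_Rsqr_abs. apply sqrt_le_1_alt.
  rewrite Rsqr_pow2. apply (sumR_term_le n i (fun j => (z j - w j) ^ 2)); [|exact Hi].
  intros; apply pow2_ge_0.
Qed.

Lemma dst_lt_of_coords (n : nat) (eps : R) : 0 < eps ->
  exists d, 0 < d /\ forall z w,
    (forall i, (i < n)%nat -> Rabs (z i - w i) < d) -> dst n z w < eps.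
Proof.
  intros He. pose proof (pos_INR n) as Hn.
  (* With [n + 1] in place of [n] the quotient makes sense for [n = 0], and
     [n d^2 < ((n + 1) d)^2 = eps^2] is strict. *)
  set (d := eps / (INR n + 1)).
  assert (Hd : 0 < d) by (apply Rdiv_lt_0_compat; lra).
  assert (Ed : d * (INR n + 1) = eps) by (unfold d; field; lra).
  exists d. split; [exact Hd|]. intros z w Hc. unfold dst.
  assert (Hs : sumR n (fun i => (z i - w i) ^ 2) <= INR n * d ^ 2).
  { rewrite <- sumR_const. apply sumR_le. intros i Hi.
    rewrite <- (pow2_abs (z i - w i)). apply pow_incr.
    split; [apply Rabs_pos | apply Rlt_le, Hc, Hi]. }
  rewrite <- (sqrt_pow2 eps) by lra. apply sqrt_lt_1_alt.
  split; [apply sumR_nonneg; intros; apply pow2_ge_0|].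
  rewrite <- Ed. nra.
Qed.

Lemma dst_eq0 (n : nat) (z w : Pt) :
  (forall i, (i < n)%nat -> z i = w i) -> dst n z w = 0.
Proof.
  intros E. unfold dst. rewrite (sumR_ext n _ (fun _ => 0)), sumR_const.
  - now rewrite Rmult_0_r, sqrt_0.
  - intros i Hi. rewrite E by exact Hi. ring.
Qed.

Lemma clos_sub (n : nat) (G : Pt -> Prop) (z : Pt) : G z -> clos n G z.
Proof. intros H eps He. exists z. split; [exact H|]. now rewrite dst_eq0. Qed.

Lemma cont_on_sub (n : nat) (S S' : Pt -> Prop) (g : Pt -> R) :
  (forall z, S' z -> S z) -> cont_on n S g -> cont_on n S' g.
Proof.
  intros Hs Hg z Hz eps He. destruct (Hg z (Hs z Hz) eps He) as [d [Hd Hd']].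
  exists d; split; auto.
Qed.

(** Points that agree in the first [n] coordinates are at distance 0, so continuity for the
    pseudometric cannot tell them apart. *)
Lemma cont_on_eq (n : nat) (S : Pt -> Prop) (g : Pt -> R) (z w : Pt) :
  cont_on n S g -> S z -> S w -> (forall i, (i < n)%nat -> z i = w i) -> g z = g w.
Proof.
  intros Hg Hz Hw E. apply cond_eq. intros eps He.
  destruct (Hg w Hw eps He) as [d [Hd Hd']]. apply Hd'; [exact Hz|].
  rewrite dst_eq0; [exact Hd | intros; symmetry; auto].
Qed.

Lemma cont_on_minus (n : nat) (S : Pt -> Prop) (g h : Pt -> R) :
  cont_on n S g -> cont_on n S h -> cont_on n S (fun z => g z - h z).
Proof.
  intros Hg Hh z Hz eps He.
  destruct (Hg z Hz (eps / 2) ltac:(lra)) as [d1 [Hd1 H1]].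
  destruct (Hh z Hz (eps / 2) ltac:(lra)) as [d2 [Hd2 H2]].
  exists (Rmin d1 d2). split; [now apply Rmin_pos|]. intros w Hw Hd.
  specialize (H1 w Hw (Rlt_le_trans _ _ _ Hd (Rmin_l _ _))).
  specialize (H2 w Hw (Rlt_le_trans _ _ _ Hd (Rmin_r _ _))).
  apply Rabs_def2 in H1, H2. apply Rabs_def1; lra.
Qed.

Lemma cont_on_const (n : nat) (S : Pt -> Prop) (c : R) : cont_on n S (fun _ => c).
Proof.
  intros z _ eps He. exists 1. split; [lra|]. intros. now rewrite Rminus_diag, Rabs_R0.
Qed.

Lemma cont2_on_slice (n : nat) (S : R -> Pt -> Prop) (S' : Pt -> Prop)
  (x : R -> Pt -> R) (t : R) :
  (forall z, S' z -> S t z) -> cont2_on n S x -> cont_on n S' (x t).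
Proof.
  intros Hs Hx z Hz eps He. destruct (Hx t z (Hs z Hz) eps He) as [d [Hd Hd']].
  exists d. split; [exact Hd|]. intros w Hw Hdw. apply Hd'; [auto|].
  rewrite Rminus_diag, Rabs_R0. now apply Rmax_lub_lt.
Qed.

Lemma cont_on_shift (n : nat) (S : Pt -> Prop) (g : Pt -> R) (c : R) :
  cont_on n S g -> cont_on n S (fun z => g z - c).
Proof. intros Hg. apply cont_on_minus; [exact Hg | apply cont_on_const]. Qed.

(** * Sequential compactness *)

Lemma subseq_ge (phi : nat -> nat) :
  (forall k, (phi k < phi (S k))%nat) -> forall k, (k <= phi k)%nat.
Proof. intros H k. induction k as [|k IH]; [lia|]. specialize (H k). lia. Qed.

Lemma subseq_mono (phi : nat -> nat) :
  (forall k, (phi k < phi (S k))%nat) -> forall j k, (j < k)%nat -> (phi j < phi k)%nat.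
Proof.
  intros H j k Hjk. induction Hjk as [|k Hjk IH]; [apply H|]. specialize (H k). lia.
Qed.

Lemma Un_cv_subseq (u : nat -> R) (l : R) (phi : nat -> nat) :
  (forall k, (phi k < phi (S k))%nat) -> Un_cv u l -> Un_cv (fun k => u (phi k)) l.
Proof.
  intros Hp Hu eps He. destruct (Hu eps He) as [N HN]. exists N. intros k Hk.
  apply HN. pose proof (subseq_ge phi Hp k). lia.
Qed.

Lemma bounded_subseq (u : nat -> R) (B : R) : (forall k, Rabs (u k) <= B) ->
  exists (phi : nat -> nat) (l : R),
    (forall k, (phi k < phi (S k))%nat) /\ Un_cv (fun k => u (phi k)) l.
Proof.
  intros HB.
  destruct (Bolzano_Weierstrass u (fun c => - B <= c <= B) (compact_P3 (- B) B))
    as [l Hl].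
  { intros k. specialize (HB k). unfold Rabs in HB. destruct (Rcase_abs (u k)); lra. }
  assert (Hc : forall N, exists p, (N <= p)%nat /\ Rabs (u p - l) < / (INR N + 1)).
  { intros N. pose proof (pos_INR N).
    assert (Hd : 0 < / (INR N + 1)) by (apply Rinv_0_lt_compat; lra).
    destruct (Hl (disc l (mkposreal _ Hd)) N) as [p Hp].
    - exists (mkposreal _ Hd). intros x Hx; exact Hx.
    - exists p. exact Hp. }
  apply choice in Hc. destruct Hc as [c Hc].
  (* Searching beyond [phi k] makes the extraction strictly increasing; as [k <= phi k], the error
     bound of [c] tends to 0 along it. *)
  set (phi := fix phi k := match k with O => c O | S k => c (S (phi k)) end).
  assert (Hphi : forall k, (phi k < phi (S k))%nat).
  { intros k. simpl. destruct (Hc (S (phi k))). lia. }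
  exists phi, l. split; [exact Hphi|].
  intros eps He. destruct (archimed_cor1 eps He) as [N [HN HN0]].
  exists (S N). intros [|k] Hk; [lia|]. unfold Rdist. simpl.
  destruct (Hc (S (phi k))) as [_ H]. apply Rlt_trans with (1 := H).
  apply Rle_lt_trans with (2 := HN). apply Rinv_le_contravar; [now apply lt_0_INR|].
  pose proof (subseq_ge phi Hphi k).
  apply Rle_trans with (INR (S (phi k))); [apply le_INR; lia | lra].
Qed.

(** Each coordinate refines the subsequence found for the earlier ones; the time is the coordinate
    treated first, in the base case. *)
Lemma bounded_subseq_Pt (n : nat) (B : R) (t : nat -> R) (z : nat -> Pt) :
  (forall k, Rabs (t k) <= B) ->
  (forall k i, (i < n)%nat -> Rabs (z k i) <= B) ->
  exists (phi : nat -> nat) (tl : R) (zl : Pt),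
    (forall k, (phi k < phi (S k))%nat) /\ Un_cv (fun k => t (phi k)) tl /\
    forall i, (i < n)%nat -> Un_cv (fun k => z (phi k) i) (zl i).
Proof.
  intros Ht. induction n as [|n IH]; intros Hz.
  - destruct (bounded_subseq t B Ht) as [phi [l [Hp Hl]]].
    exists phi, l, (fun _ => 0). repeat split; auto. intros; lia.
  - destruct IH as [phi [tl [zl [Hp [Htl Hzl]]]]]; [intros; apply Hz; lia|].
    destruct (bounded_subseq (fun k => z (phi k) n) B) as [psi [l [Hq Hl]]].
    { intros; apply Hz; lia. }
    exists (fun k => phi (psi k)), tl, (upd zl n l). repeat split.
    + intros k. now apply subseq_mono.
    + exact (Un_cv_subseq _ _ psi Hq Htl).
    + intros i Hi. unfold upd. destruct (Nat.eq_dec i n) as [->|ne]; [exact Hl|].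
      apply (Un_cv_subseq (fun k => z (phi k) i)); [exact Hq | apply Hzl; lia].
Qed.

Lemma coords_eventually (n : nat) (z : nat -> Pt) (zl : Pt) (d : R) : 0 < d ->
  (forall i, (i < n)%nat -> Un_cv (fun k => z k i) (zl i)) ->
  exists N, forall k, (N <= k)%nat -> forall i, (i < n)%nat -> Rabs (zl i - z k i) < d.
Proof.
  intros Hd. induction n as [|n IH]; intros Hz; [exists O; intros; lia|].
  destruct IH as [N1 H1]; [intros; apply Hz; lia|].
  destruct (Hz n ltac:(lia) d Hd) as [N2 H2].
  exists (max N1 N2). intros k Hk i Hi.
  destruct (Nat.eq_dec i n) as [->|ne]; [|apply H1; lia].
  rewrite Rabs_minus_sym. apply H2. lia.
Qed.

Definition cyl (n : nat) (G : Pt -> Prop) (T t : R) (z : Pt) : Prop :=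
  0 <= t <= T /\ clos n G z.

(** Compactness of the closed cylinder, in the form in which every later compactness argument uses
    it: a continuous function is compared with its value at the cluster point. *)
Lemma cyl_cluster_point (n : nat) (G : Pt -> Prop) (T : R) (t : nat -> R) (z : nat -> Pt) :
  gbounded n G -> (forall k, cyl n G T (t k) (z k)) ->
  exists tl zl, cyl n G T tl zl /\
    forall d N, 0 < d -> exists k, (N <= k)%nat /\
      Rmax (Rabs (t k - tl)) (dst n zl (z k)) < d.
Proof.
  intros [B HB] HK.
  destruct (bounded_subseq_Pt n (Rmax T (B + 1)) t z) as [phi [tl [zl [Hp [Ht Hz]]]]].
  { intros k. destruct (HK k) as [Hk _]. rewrite Rabs_right by lra.
    apply Rle_trans with T; [lra | apply Rmax_l]. }
  (* A point of the closure lies within 1 of a point of [G], whence the bound [B + 1]. *)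
  { intros k i Hi. destruct (HK k) as [_ Hk]. destruct (Hk 1 ltac:(lra)) as [w [Hw Hd]].
    apply HB in Hw. pose proof (coord_le_dst n i _ _ Hi : Rabs (z k i - w i) <= _).
    pose proof (coord_le_dst n i w (fun _ => 0) Hi) as Hw'. rewrite Rminus_0_r in Hw'.
    apply Rle_trans with (2 := Rmax_r T (B + 1)).
    replace (z k i) with ((z k i - w i) + w i) by ring.
    apply Rle_trans with (1 := Rabs_triang _ _). lra. }
  assert (Hcl : forall d N, 0 < d -> exists k, (N <= k)%nat /\
    Rmax (Rabs (t k - tl)) (dst n zl (z k)) < d).
  { intros d N Hd. destruct (dst_lt_of_coords n d Hd) as [d' [Hd' Hdst]].
    destruct (coords_eventually n (fun k => z (phi k)) zl d' Hd' Hz) as [N1 H1].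
    destruct (Ht d Hd) as [N2 H2].
    set (k := max N (max N1 N2)). exists (phi k).
    pose proof (subseq_ge phi Hp k). split; [lia|].
    apply Rmax_lub_lt; [apply H2; lia|]. apply Hdst. apply H1. lia. }
  exists tl, zl. split; [split|exact Hcl].
  - split; apply Rnot_lt_le; intros Hlt.
    + destruct (Hcl (- tl) O ltac:(lra)) as [k [_ Hk]].
      apply Rle_lt_trans with (1 := Rmax_l _ _) in Hk. apply Rabs_def2 in Hk.
      destruct (HK k). lra.
    + destruct (Hcl (tl - T) O ltac:(lra)) as [k [_ Hk]].
      apply Rle_lt_trans with (1 := Rmax_l _ _) in Hk. apply Rabs_def2 in Hk.
      destruct (HK k). lra.
  - intros eps He. destruct (dst_lt_of_coords n eps He) as [d [Hd Hdst]].
    destruct (Hcl (d / 2) O ltac:(lra)) as [k [_ Hk]].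
    apply Rle_lt_trans with (1 := Rmax_r _ _) in Hk.
    destruct (HK k) as [_ HKk]. destruct (HKk (d / 2) ltac:(lra)) as [w [Hw Hzw]].
    exists w. split; [exact Hw|]. apply Hdst. intros i Hi.
    pose proof (coord_le_dst n i zl (z k) Hi). pose proof (coord_le_dst n i (z k) w Hi).
    replace (zl i - w i) with ((zl i - z k i) + (z k i - w i)) by ring.
    apply Rle_lt_trans with (1 := Rabs_triang _ _). lra.
Qed.

(** Otherwise points where [w] exceeds [INR k] would cluster in the cylinder, against continuity at
    the cluster point. *)
Lemma cyl_bounded_above (n : nat) (G : Pt -> Prop) (T : R) (w : R -> Pt -> R) :
  gbounded n G -> cont2_on n (cyl n G T) w ->
  exists B, forall t z, cyl n G T t z -> w t z <= B.
Proof.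
  intros HG Hw. apply NNPP. intros Hno.
  assert (Hs : forall k : nat, exists tz : R * Pt,
    cyl n G T (fst tz) (snd tz) /\ INR k < w (fst tz) (snd tz)).
  { intros k. apply NNPP. intros H. apply Hno. exists (INR k). intros t z Hz.
    apply Rnot_lt_le. intros Hlt. apply H. now exists (t, z). }
  apply choice in Hs. destruct Hs as [s Hs].
  destruct (cyl_cluster_point n G T (fun k => fst (s k)) (fun k => snd (s k)) HG)
    as [t [z [HK Hc]]]; [intros; apply Hs|].
  destruct (Hw t z HK 1 ltac:(lra)) as [d [Hd Hd']].
  destruct (INR_unbounded (w t z + 1)) as [N HN].
  destruct (Hc d N Hd) as [k [Hk Hkd]]. destruct (Hs k) as [Hsk1 Hsk2].
  specialize (Hd' _ _ Hsk1 Hkd). apply Rabs_def2 in Hd'. apply le_INR in Hk. lra.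
Qed.

(** A sequence with values within [/ (INR k + 1)] of the supremum clusters at a point where, by
    continuity, the supremum is attained. *)
Lemma cyl_max (n : nat) (G : Pt -> Prop) (T : R) (w : R -> Pt -> R) (t1 : R) (z1 : Pt) :
  gbounded n G -> cont2_on n (cyl n G T) w -> cyl n G T t1 z1 ->
  exists t0 z0, cyl n G T t0 z0 /\ forall t z, cyl n G T t z -> w t z <= w t0 z0.
Proof.
  intros HG Hw H1. destruct (cyl_bounded_above n G T w HG Hw) as [B HB].
  destruct (completeness (fun r => exists t z, cyl n G T t z /\ r = w t z)) as [m [Hub Hlub]].
  { exists B. intros r [t [z [H ->]]]. now apply HB. }
  { exists (w t1 z1), t1, z1. auto. }
  assert (Hs : forall k : nat, exists tz : R * Pt,
    cyl n G T (fst tz) (snd tz) /\ m - / (INR k + 1) < w (fst tz) (snd tz)).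
  { intros k. apply NNPP. intros H. pose proof (pos_INR k).
    assert (0 < / (INR k + 1)) by (apply Rinv_0_lt_compat; lra).
    assert (m <= m - / (INR k + 1)); [|lra]. apply Hlub. intros r [t [z [Hz ->]]].
    apply Rnot_lt_le. intros Hlt. apply H. now exists (t, z). }
  apply choice in Hs. destruct Hs as [s Hs].
  destruct (cyl_cluster_point n G T (fun k => fst (s k)) (fun k => snd (s k)) HG)
    as [t [z [HK Hc]]]; [intros; apply Hs|].
  exists t, z. split; [exact HK|]. intros t' z' H'.
  apply Rle_trans with m; [apply Hub; eauto|]. apply Rnot_lt_le. intros Hlt.
  set (e := (m - w t z) / 2). assert (He : 0 < e) by (unfold e; lra).
  destruct (Hw t z HK e He) as [d [Hd Hd']].
  destruct (archimed_cor1 e He) as [N [HN HN0]].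
  destruct (Hc d N Hd) as [k [Hk Hkd]]. destruct (Hs k) as [Hsk1 Hsk2].
  specialize (Hd' _ _ Hsk1 Hkd). apply Rabs_def2 in Hd'. apply le_INR in Hk.
  assert (/ (INR k + 1) <= / INR N).
  { apply Rinv_le_contravar; [now apply lt_0_INR | lra]. }
  unfold e in *. lra.
Qed.

Lemma cont_on_bounded (n : nat) (G : Pt -> Prop) (g : Pt -> R) :
  gbounded n G -> cont_on n (clos n G) g ->
  exists B, forall z, clos n G z -> Rabs (g z) <= B.
Proof.
  intros HG Hg.
  (* A cylinder of height 0 is a copy of the closure of [G]. *)
  destruct (cyl_bounded_above n G 0 (fun _ z => Rabs (g z)) HG) as [B HB].
  - intros t z [_ Hz] eps He. destruct (Hg z Hz eps He) as [d [Hd Hd']].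
    exists d. split; [exact Hd|]. intros s w [_ Hw] Hdw.
    apply Rle_lt_trans with (1 := Rabs_triang_inv2 _ _). apply Hd'; [exact Hw|].
    apply Rle_lt_trans with (2 := Hdw), Rmax_r.
  - exists B. intros z Hz. apply (HB 0). split; [lra | exact Hz].
Qed.

(** Provides the width [delta] at which (H3) is applied. Were there no such width, points of [G]
    with [g] above [r + eps] would cluster at a boundary point, where [g] is at most [r]. *)
Lemma near_bdry_le (n : nat) (G : Pt -> Prop) (g : Pt -> R) (r eps : R) :
  gopen n G -> gbounded n G -> cont_on n (clos n G) g ->
  (forall z, bdry n G z -> g z <= r) -> 0 < eps ->
  exists delta, 0 < delta /\ forall z s, G z -> bdry n G s -> dst n z s < delta ->
    g z <= r + eps.
Proof.
  intros HGo HG Hg Hr He. apply NNPP. intros Hno.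
  assert (Hs : forall k : nat, exists zs : Pt * Pt,
    G (fst zs) /\ bdry n G (snd zs) /\ dst n (fst zs) (snd zs) < / (INR k + 1) /\
    r + eps < g (fst zs)).
  { intros k. apply NNPP. intros H. apply Hno. exists (/ (INR k + 1)).
    pose proof (pos_INR k). split; [apply Rinv_0_lt_compat; lra|].
    intros z s Hz Hbs Hd. apply Rnot_lt_le. intros Hlt. apply H. now exists (z, s). }
  apply choice in Hs. destruct Hs as [s Hs].
  destruct (cyl_cluster_point n G 0 (fun _ => 0) (fun k => fst (s k)) HG)
    as [t [z [[_ Hz] Hc]]].
  { intros k. split; [lra|]. apply clos_sub, Hs. }
  (* If the cluster point were in [G], a ball around it inside [G] would contain some of the
     boundary points [snd (s k)]. *)
  assert (Hb : bdry n G z).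
  { split; [exact Hz|]. intros Gz. destruct (HGo z Gz) as [rho [Hrho Hball]].
    destruct (dst_lt_of_coords n rho Hrho) as [d [Hd Hdst]].
    destruct (archimed_cor1 (d / 2) ltac:(lra)) as [N [HN HN0]].
    destruct (Hc (d / 2) N ltac:(lra)) as [k [Hk Hkd]].
    apply Rle_lt_trans with (1 := Rmax_r _ _) in Hkd.
    destruct (Hs k) as [_ [[_ Hns] [Hzs _]]]. apply Hns, Hball, Hdst. intros i Hi.
    apply le_INR in Hk.
    assert (/ (INR k + 1) <= / INR N).
    { apply Rinv_le_contravar; [now apply lt_0_INR | lra]. }
    pose proof (coord_le_dst n i z (fst (s k)) Hi).
    pose proof (coord_le_dst n i (fst (s k)) (snd (s k)) Hi).
    replace (z i - snd (s k) i) with ((z i - fst (s k) i) + (fst (s k) i - snd (s k) i)) by ring.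
    apply Rle_lt_trans with (1 := Rabs_triang _ _). lra. }
  destruct (Hg z Hz eps He) as [d [Hd Hd']].
  destruct (Hc d O Hd) as [k [_ Hkd]]. apply Rle_lt_trans with (1 := Rmax_r _ _) in Hkd.
  destruct (Hs k) as [HGk [_ [_ Hgk]]].
  specialize (Hd' _ (clos_sub n G _ HGk) Hkd). apply Rabs_def2 in Hd'.
  specialize (Hr z Hb). lra.
Qed.

(** * One-variable calculus *)

Lemma MVT_abs (f f' : R -> R) (a h : R) :
  (forall c, Rabs (c - a) <= Rabs h -> derivable_pt_lim f c (f' c)) ->
  exists c, Rabs (c - a) <= Rabs h /\ f (a + h) - f a = f' c * h.
Proof.
  intros Hd. destruct (Rtotal_order h 0) as [Hh|[->|Hh]].
  - destruct (MVT_cor2 f f' (a + h) a) as [c [E Hc]]; [lra| |].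
    + intros c Hc. apply Hd. rewrite (Rabs_left h) by lra. apply Rabs_le. lra.
    + exists c. split; [rewrite (Rabs_left h) by lra; apply Rabs_le; lra | lra].
  - exists a. rewrite Rminus_diag, Rplus_0_r. split; [lra | ring].
  - destruct (MVT_cor2 f f' a (a + h)) as [c [E Hc]]; [lra| |].
    + intros c Hc. apply Hd. rewrite (Rabs_right h) by lra. apply Rabs_le. lra.
    + exists c. split; [rewrite (Rabs_right h) by lra; apply Rabs_le; lra | lra].
Qed.

Lemma derivable_pt_lim_ext (f g : R -> R) (x l : R) :
  (forall s, f s = g s) -> derivable_pt_lim f x l -> derivable_pt_lim g x l.
Proof. intros E. now rewrite (functional_extensionality f g E). Qed.

Lemma derivable_pt_lim_sumR (n : nat) (f : nat -> R -> R) (l : nat -> R) (x : R) :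
  (forall i, (i < n)%nat -> derivable_pt_lim (f i) x (l i)) ->
  derivable_pt_lim (fun s => sumR n (fun i => f i s)) x (sumR n l).
Proof.
  induction n as [|n IH]; intros Hf; [apply derivable_pt_lim_const|].
  rewrite sumR_S. apply derivable_pt_lim_ext with
    (f := plus_fct (fun s => sumR n (fun i => f i s)) (f n)).
  - intros s. unfold plus_fct. now rewrite sumR_S.
  - apply derivable_pt_lim_plus; auto.
Qed.

(** Only earlier arguments are compared: in the comparison principle the maximum may sit at the
    final time of the cylinder. *)
Lemma left_max_derivative_nonneg (f : R -> R) (t l d : R) :
  derivable_pt_lim f t l -> 0 < d ->
  (forall h, 0 < h < d -> f (t - h) <= f t) -> 0 <= l.
Proof.
  intros Hf Hd Hm. apply Rnot_lt_le. intros Hl.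
  destruct (Hf (- l) ltac:(lra)) as [e He]. pose proof (cond_pos e).
  set (h := Rmin d e / 2).
  assert (Hh : 0 < h < d /\ h < e).
  { unfold h. pose proof (Rmin_l d e). pose proof (Rmin_r d e).
    assert (0 < Rmin d e) by now apply Rmin_pos. lra. }
  specialize (He (- h) ltac:(apply Rlt_not_eq; lra)). rewrite Rabs_Ropp, Rabs_right in He by lra.
  specialize (He ltac:(lra)). specialize (Hm h ltac:(lra)). apply Rabs_def2 in He.
  unfold Rminus in Hm. set (q := (f (t + - h) - f t) / - h) in He.
  assert (f (t + - h) - f t = - h * q) by (unfold q; field; lra). nra.
Qed.

Lemma interior_max_derivative (f : R -> R) (x l d : R) :
  derivable_pt_lim f x l -> 0 < d ->
  (forall h, Rabs h < d -> f (x + h) <= f x) -> l = 0.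
Proof.
  intros Hf Hd Hm. apply Rle_antisym.
  - assert (0 <= - l); [|lra].
    apply (left_max_derivative_nonneg (fun s => f (- s)) (- x) (- l) d); [|exact Hd|].
    + replace (- l) with (l * - 1) by ring.
      apply (derivable_pt_lim_comp (fun s => - s) f (- x) (- 1) l).
      * apply (derivable_pt_lim_opp id), derivable_pt_lim_id.
      * now rewrite Ropp_involutive.
    + intros h Hh. replace (- (- x - h)) with (x + h) by ring. rewrite Ropp_involutive.
      apply Hm. rewrite Rabs_right; lra.
  - apply (left_max_derivative_nonneg f x l d Hf Hd). intros h Hh.
    apply (Hm (- h)). rewrite Rabs_Ropp, Rabs_right; lra.
Qed.

(** Since [f'] vanishes at the maximum, [l > 0] would make [f'] positive just to the right of 0, and
    the mean value theorem would give values above [f 0]. *)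
Lemma second_derivative_test (f f' : R -> R) (l d : R) : 0 < d ->
  (forall s, Rabs s < d -> derivable_pt_lim f s (f' s)) ->
  derivable_pt_lim f' 0 l -> (forall s, Rabs s < d -> f s <= f 0) -> l <= 0.
Proof.
  intros Hd Hf Hf' Hm. apply Rnot_lt_le. intros Hl.
  assert (H0 : f' 0 = 0).
  { apply (interior_max_derivative f 0 (f' 0) d); [apply Hf|exact Hd|].
    - now rewrite Rabs_R0.
    - intros h Hh. rewrite Rplus_0_l. now apply Hm. }
  destruct (Hf' l Hl) as [e He]. pose proof (cond_pos e).
  assert (Hmin : 0 < Rmin d e) by now apply Rmin_pos.
  pose proof (Rmin_l d e). pose proof (Rmin_r d e).
  set (s := Rmin d e / 2). assert (Hs : 0 < s < Rmin d e) by (unfold s; lra).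
  destruct (MVT_cor2 f f' 0 s) as [c [E Hc]]; [lra| |].
  - intros c Hc. apply Hf. rewrite Rabs_right; lra.
  - specialize (Hm s ltac:(rewrite Rabs_right; lra)).
    specialize (He c ltac:(apply Rgt_not_eq; lra) ltac:(rewrite Rabs_right; lra)).
    rewrite Rplus_0_l, H0, Rminus_0_r in He. apply Rabs_def2 in He.
    assert (0 < f' c).
    { replace (f' c) with (c * (f' c / c)) by (field; lra). apply Rmult_lt_0_compat; lra. }
    nra.
Qed.

Lemma mixed_partials_eq (F F1 F2 F12 F21 : R -> R -> R) (a b d : R) : 0 < d ->
  (forall u v, Rabs (u - a) < d -> Rabs (v - b) < d ->
    derivable_pt_lim (fun s => F s v) u (F1 u v) /\
    derivable_pt_lim (fun s => F u s) v (F2 u v) /\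
    derivable_pt_lim (fun s => F1 u s) v (F12 u v) /\
    derivable_pt_lim (fun s => F2 s v) u (F21 u v)) ->
  (forall eps, 0 < eps -> exists d', 0 < d' /\
    forall u v, Rabs (u - a) < d' -> Rabs (v - b) < d' ->
      Rabs (F12 u v - F12 a b) < eps /\ Rabs (F21 u v - F21 a b) < eps) ->
  F12 a b = F21 a b.
Proof.
  intros Hd HF HC. apply cond_eq. intros eps He.
  destruct (HC (eps / 2) ltac:(lra)) as [d' [Hd' Hc]].
  assert (Hmin : 0 < Rmin d d') by now apply Rmin_pos.
  pose proof (Rmin_l d d'). pose proof (Rmin_r d d').
  set (h := Rmin d d' / 2). assert (Hh : 0 < h < Rmin d d') by (unfold h; lra).
  assert (Hb : forall x y, x <= y <= x + h -> Rabs (y - x) < d /\ Rabs (y - x) < d').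
  { intros x y Hxy. rewrite Rabs_right by lra. lra. }
  (* The second difference of [F] over a square of side [h] is [h ^ 2] times either mixed
     derivative at a point of the square. *)
  assert (E1 : exists u v, a <= u <= a + h /\ b <= v <= b + h /\
    F (a + h) (b + h) - F (a + h) b - (F a (b + h) - F a b) = F12 u v * h * h).
  { destruct (MVT_cor2 (fun u => F u (b + h) - F u b) (fun u => F1 u (b + h) - F1 u b) a (a + h))
      as [u [Eu Hu]]; [lra| |].
    - intros u Hu. apply derivable_pt_lim_minus; apply HF; apply Hb; lra.
    - destruct (MVT_cor2 (F1 u) (F12 u) b (b + h)) as [v [Ev Hv]]; [lra| |].
      + intros v Hv. apply HF; apply Hb; lra.
      + exists u, v. split; [lra|]. split; [lra|]. rewrite Eu, Ev. ring. }
  assert (E2 : exists u v, a <= u <= a + h /\ b <= v <= b + h /\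
    F (a + h) (b + h) - F (a + h) b - (F a (b + h) - F a b) = F21 u v * h * h).
  { destruct (MVT_cor2 (fun v => F (a + h) v - F a v) (fun v => F2 (a + h) v - F2 a v) b (b + h))
      as [v [Ev Hv]]; [lra| |].
    - intros v Hv. apply derivable_pt_lim_minus; apply HF; apply Hb; lra.
    - destruct (MVT_cor2 (fun u => F2 u v) (fun u => F21 u v) a (a + h)) as [u [Eu Hu]]; [lra| |].
      + intros u Hu. apply HF; apply Hb; lra.
      + exists u, v. split; [lra|]. split; [lra|].
        transitivity (F (a + h) (b + h) - F a (b + h) - (F (a + h) b - F a b)); [ring|].
        rewrite Ev, Eu. ring. }
  destruct E1 as [u [v [Hu [Hv E1]]]]. destruct E2 as [u' [v' [Hu' [Hv' E2]]]].
  assert (E : F12 u v = F21 u' v').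
  { rewrite E1 in E2. apply Rmult_eq_reg_r with h; [|lra].
    apply Rmult_eq_reg_r with h; [exact E2 | lra]. }
  destruct (Hc u v) as [H1 _]; [apply Hb; lra | apply Hb; lra|].
  destruct (Hc u' v') as [_ H2]; [apply Hb; lra | apply Hb; lra|].
  rewrite E in H1. apply Rabs_def2 in H1, H2. apply Rabs_def1; lra.
Qed.

(** * Calculus of several variables *)

Lemma upd_same (z : Pt) (i : nat) (h : R) : upd z i h i = h.
Proof. unfold upd. destruct (Nat.eq_dec i i); congruence. Qed.

Lemma upd_other (z : Pt) (i j : nat) (h : R) : j <> i -> upd z i h j = z j.
Proof. intros. unfold upd. destruct (Nat.eq_dec j i); congruence. Qed.

Lemma upd_id (z : Pt) (i : nat) : upd z i (z i) = z.
Proof.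
  apply functional_extensionality. intros k. unfold upd.
  destruct (Nat.eq_dec k i); congruence.
Qed.

Lemma upd_upd (z : Pt) (i : nat) (h k : R) : upd (upd z i h) i k = upd z i k.
Proof.
  apply functional_extensionality. intros j. unfold upd.
  destruct (Nat.eq_dec j i); congruence.
Qed.

Lemma upd_comm (z : Pt) (i j : nat) (h k : R) : i <> j ->
  upd (upd z i h) j k = upd (upd z j k) i h.
Proof.
  intros ne. apply functional_extensionality. intros l. unfold upd.
  destruct (Nat.eq_dec l i), (Nat.eq_dec l j); congruence.
Qed.

Definition partials (n : nat) (G : Pt -> Prop) (g : Pt -> R) (D : nat -> Pt -> R) : Prop :=
  forall i z, (i < n)%nat -> G z ->
    derivable_pt_lim (fun h => g (upd z i h)) (z i) (D i z).

Lemma partials_upd (n : nat) (G : Pt -> Prop) (g : Pt -> R) (D : nat -> Pt -> R)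
  (i : nat) (z : Pt) (s : R) :
  partials n G g D -> (i < n)%nat -> G (upd z i s) ->
  derivable_pt_lim (fun h => g (upd z i h)) s (D i (upd z i s)).
Proof.
  intros HD Hi Hz. specialize (HD i _ Hi Hz). rewrite upd_same in HD.
  revert HD. apply derivable_pt_lim_ext. intros h. now rewrite upd_upd.
Qed.

Definition line (z b : Pt) (s : R) : Pt := fun i => z i + s * b i.

Lemma line_line (z b : Pt) (s h : R) : line (line z b s) b h = line z b (s + h).
Proof. apply functional_extensionality. intros i. unfold line. ring. Qed.

Lemma line_0 (z b : Pt) : line z b 0 = z.
Proof. apply functional_extensionality. intros i. unfold line. ring. Qed.

(** The coordinatewise hypothesis covers the points of the segment from [z] to [line z b h] as well
    as those of the axis-parallel path between the same ends. *)
Lemma box_near (n : nat) (z b : Pt) (r : R) : 0 < r ->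
  exists d, 0 < d /\ forall h w, Rabs h < d ->
    (forall i, (i < n)%nat -> Rabs (w i - z i) <= Rabs h * Rabs (b i)) -> dst n z w < r.
Proof.
  intros Hr. destruct (dst_lt_of_coords n r Hr) as [d [Hd Hdst]].
  set (c := sumR n (fun i => Rabs (b i)) + 1).
  assert (Hc : 1 <= c).
  { unfold c. pose proof (sumR_nonneg n (fun i => Rabs (b i)) (fun i _ => Rabs_pos _)). lra. }
  exists (d / c). split; [apply Rdiv_lt_0_compat; lra|].
  intros h w Hh Hw. apply Hdst. intros i Hi. rewrite Rabs_minus_sym.
  apply Rle_lt_trans with (1 := Hw i Hi).
  assert (Hb : Rabs (b i) <= c).
  { unfold c. pose proof (sumR_term_le n i (fun i => Rabs (b i)) (fun i _ => Rabs_pos _) Hi).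
    simpl in *. lra. }
  apply Rle_lt_trans with (Rabs h * c).
  - apply Rmult_le_compat_l; [apply Rabs_pos | exact Hb].
  - replace d with (d / c * c) by (field; lra). apply Rmult_lt_compat_r; lra.
Qed.

(** Corners of an axis-parallel path from [z] towards [line z b h]: each leg changes one coordinate,
    so a partial derivative controls the increment along it. *)
Definition stair (z b : Pt) (h : R) (m : nat) : Pt :=
  fun i => if Nat.ltb i m then z i + h * b i else z i.

Lemma stair_lt (z b : Pt) (h : R) (m i : nat) : (i < m)%nat -> stair z b h m i = line z b h i.
Proof. intros Hi. unfold stair. apply Nat.ltb_lt in Hi. now rewrite Hi. Qed.

Lemma stair_ge (z b : Pt) (h : R) (m i : nat) : (m <= i)%nat -> stair z b h m i = z i.
Proof. intros Hi. unfold stair. apply Nat.ltb_ge in Hi. now rewrite Hi. Qed.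

Lemma stair_S (z b : Pt) (h : R) (m : nat) :
  stair z b h (S m) = upd (stair z b h m) m (z m + h * b m).
Proof.
  apply functional_extensionality. intros i. unfold upd.
  destruct (Nat.eq_dec i m) as [->|ne]; [rewrite stair_lt by lia; reflexivity|].
  destruct (Nat.lt_ge_cases i m).
  - now rewrite !stair_lt by lia.
  - now rewrite !stair_ge by lia.
Qed.

(** Continuous partial derivatives give differentiability: the increment telescopes along the
    corners [stair], and on each leg the mean value theorem yields a partial derivative at a point
    close to [z]. *)
Lemma line_increment (n : nat) (G : Pt -> Prop) (g : Pt -> R) (D : nat -> Pt -> R) (z b : Pt) :
  gopen n G -> cont_on n G g -> partials n G g D ->
  (forall i, (i < n)%nat -> cont_on n G (D i)) -> G z ->
  forall eta, 0 < eta -> exists d, 0 < d /\ forall h, Rabs h < d ->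
    Rabs (g (line z b h) - g z - h * sumR n (fun i => b i * D i z)) <= eta * Rabs h.
Proof.
  intros HGo Hg HD HDc Hz.
  destruct (HGo z Hz) as [rho [Hrho Hball]].
  assert (Hm : forall m, (m <= n)%nat -> forall eta, 0 < eta -> exists d, 0 < d /\
    forall h, Rabs h < d ->
    Rabs (g (stair z b h m) - g z - h * sumR m (fun i => b i * D i z)) <= eta * Rabs h).
  { induction m as [|m IH]; intros Hmn eta Heta.
    - exists 1. split; [lra|]. intros h _. change (stair z b h 0) with z.
      rewrite sumR_0, Rmult_0_r, !Rminus_diag, Rabs_R0.
      apply Rmult_le_pos; [lra | apply Rabs_pos].
    - destruct (IH ltac:(lia) (eta / 2) ltac:(lra)) as [d1 [Hd1 H1]].
      pose proof (Rabs_pos (b m)) as Hbm.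
      (* Half of [eta] is left to the earlier legs; this [e] keeps the error of leg [m], at most
         [e * Rabs (b m) * Rabs h], within the other half. *)
      set (e := eta / 2 / (Rabs (b m) + 1)).
      assert (He : 0 < e) by (apply Rdiv_lt_0_compat; lra).
      assert (Ee : e * (Rabs (b m) + 1) = eta / 2) by (unfold e; field; lra).
      destruct (HDc m ltac:(lia) z Hz e He) as [d2 [Hd2 H2]].
      destruct (box_near n z b (Rmin rho d2)) as [d3 [Hd3 H3]]; [now apply Rmin_pos|].
      exists (Rmin d1 d3). split; [now apply Rmin_pos|]. intros h Hh.
      specialize (H1 h (Rlt_le_trans _ _ _ Hh (Rmin_l _ _))).
      pose proof (Rlt_le_trans _ _ _ Hh (Rmin_r _ _)) as Hh3.
      assert (Hin : forall c, Rabs (c - z m) <= Rabs (h * b m) ->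
        G (upd (stair z b h m) m c) /\ Rabs (D m (upd (stair z b h m) m c) - D m z) < e).
      { intros c Hc. assert (Hd : dst n z (upd (stair z b h m) m c) < Rmin rho d2).
        { apply (H3 h); [exact Hh3|]. intros i Hi. destruct (Nat.eq_dec i m) as [->|ne].
          - rewrite upd_same, <- Rabs_mult. exact Hc.
          - rewrite upd_other, <- Rabs_mult by exact ne. destruct (Nat.lt_ge_cases i m).
            + rewrite stair_lt by lia. unfold line. right. f_equal. ring.
            + rewrite stair_ge, Rminus_diag, Rabs_R0 by lia. apply Rabs_pos. }
        assert (HG : G (upd (stair z b h m) m c)).
        { apply Hball. apply Rlt_le_trans with (1 := Hd), Rmin_l. }
        split; [exact HG|]. apply H2; [exact HG|].
        apply Rlt_le_trans with (1 := Hd), Rmin_r. }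
      destruct (MVT_abs (fun c => g (upd (stair z b h m) m c))
        (fun c => D m (upd (stair z b h m) m c)) (z m) (h * b m)) as [c [Hc Ec]].
      { intros c Hc. apply (partials_upd n G g D); [exact HD | lia | now apply Hin]. }
      destruct (Hin c Hc) as [_ HDm]. rewrite <- stair_S in Ec.
      assert (Em : upd (stair z b h m) m (z m) = stair z b h m).
      { rewrite <- (stair_ge z b h m m (le_n m)). apply upd_id. }
      rewrite Em in Ec.
      rewrite sumR_S.
      replace (g (stair z b h (S m)) - g z - h * (sumR m (fun i => b i * D i z) + b m * D m z))
        with ((g (stair z b h m) - g z - h * sumR m (fun i => b i * D i z)) +
              (D m (upd (stair z b h m) m c) - D m z) * (h * b m)) by lra.
      apply Rle_trans with (1 := Rabs_triang _ _). rewrite !Rabs_mult.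
      set (q := Rabs (D m (upd (stair z b h m) m c) - D m z)) in *.
      pose proof (Rabs_pos h). assert (0 <= q) by apply Rabs_pos.
      assert (q * Rabs (b m) <= eta / 2) by nra.
      assert (q * Rabs (b m) * Rabs h <= eta / 2 * Rabs h) by (apply Rmult_le_compat_r; lra).
      lra. }
  intros eta Heta. destruct (Hm n (le_n n) eta Heta) as [d [Hd H]].
  destruct (box_near n z b rho Hrho) as [d' [Hd' H']].
  exists (Rmin d d'). split; [now apply Rmin_pos|]. intros h Hh.
  specialize (H h (Rlt_le_trans _ _ _ Hh (Rmin_l _ _))).
  pose proof (Rlt_le_trans _ _ _ Hh (Rmin_r _ _)) as Hh'.
  assert (HG : forall w, (forall i, (i < n)%nat -> w i = line z b h i) -> G w).
  { intros w Ew. apply Hball, (H' h); [exact Hh'|]. intros i Hi.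
    rewrite (Ew i Hi), <- Rabs_mult. unfold line. right. f_equal. ring. }
  (* The last corner agrees with [line z b h] in the first [n] coordinates only, hence the passage
     through [cont_on_eq]. *)
  rewrite (cont_on_eq n G g (line z b h) (stair z b h n)); [exact H|exact Hg| | |].
  - apply HG. reflexivity.
  - apply HG. intros; now apply stair_lt.
  - intros; symmetry; now apply stair_lt.
Qed.

Lemma line_derivative (n : nat) (G : Pt -> Prop) (g : Pt -> R) (D : nat -> Pt -> R)
  (z b : Pt) (s : R) :
  gopen n G -> cont_on n G g -> partials n G g D ->
  (forall i, (i < n)%nat -> cont_on n G (D i)) -> G (line z b s) ->
  derivable_pt_lim (fun s => g (line z b s)) s
    (sumR n (fun i => b i * D i (line z b s))).
Proof.
  intros HGo Hg HD HDc Hz eps He.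
  destruct (line_increment n G g D (line z b s) b HGo Hg HD HDc Hz (eps / 2) ltac:(lra))
    as [d [Hd H]].
  exists (mkposreal d Hd). intros h Hh0 Hh. simpl in Hh. specialize (H h Hh).
  rewrite line_line in H.
  set (l := sumR n (fun i => b i * D i (line z b s))) in *.
  replace ((g (line z b (s + h)) - g (line z b s)) / h - l)
    with ((g (line z b (s + h)) - g (line z b s) - h * l) / h) by (field; exact Hh0).
  unfold Rdiv. rewrite Rabs_mult, Rabs_inv. pose proof (Rabs_pos_lt h Hh0).
  apply Rle_lt_trans with (eps / 2 * Rabs h * / Rabs h).
  - apply Rmult_le_compat_r; [left; now apply Rinv_0_lt_compat | exact H].
  - field_simplify; lra.
Qed.

(** Schwarz's theorem, by restriction to the plane of the coordinates [i] and [j]. The trace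
    argument needs it because [A] is not assumed symmetric. *)
Lemma second_partials_sym (n : nat) (G : Pt -> Prop) (g : Pt -> R)
  (D : nat -> Pt -> R) (H : nat -> nat -> Pt -> R) (z : Pt) (i j : nat) :
  gopen n G -> partials n G g D ->
  (forall j, (j < n)%nat -> partials n G (D j) (fun i => H i j)) ->
  (forall i j, (i < n)%nat -> (j < n)%nat -> cont_on n G (H i j)) ->
  G z -> (i < n)%nat -> (j < n)%nat -> H i j z = H j i z.
Proof.
  intros HGo HD HH HHc Hz Hi Hj. destruct (Nat.eq_dec i j) as [->|ne]; [reflexivity|].
  destruct (HGo z Hz) as [rho [Hrho Hball]].
  set (pt := fun u v => upd (upd z i u) j v).
  assert (Ez : pt (z i) (z j) = z).
  { unfold pt. rewrite <- (upd_other z i j (z i)) by congruence. now rewrite !upd_id. }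
  assert (Hpt : forall r, 0 < r -> exists d, 0 < d /\ forall u v,
    Rabs (u - z i) < d -> Rabs (v - z j) < d -> dst n z (pt u v) < r).
  { intros r Hr. destruct (dst_lt_of_coords n r Hr) as [d [Hd Hdst]].
    exists d. split; [exact Hd|]. intros u v Hu Hv. apply Hdst. intros k Hk.
    unfold pt, upd. destruct (Nat.eq_dec k j) as [->|]; [now rewrite Rabs_minus_sym|].
    destruct (Nat.eq_dec k i) as [->|]; [now rewrite Rabs_minus_sym|].
    now rewrite Rminus_diag, Rabs_R0. }
  destruct (Hpt rho Hrho) as [d [Hd Hd']].
  symmetry. rewrite <- Ez.
  apply (mixed_partials_eq (fun u v => g (pt u v)) (fun u v => D i (pt u v))
    (fun u v => D j (pt u v)) (fun u v => H j i (pt u v)) (fun u v => H i j (pt u v))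
    (z i) (z j) d Hd).
  - intros u v Hu Hv.
    assert (HG : G (pt u v)) by (apply Hball, Hd'; assumption).
    assert (Epi : forall s, pt s v = upd (upd z j v) i s) by (intros; now apply upd_comm).
    assert (Hi' : forall (h : Pt -> R) E, partials n G h E ->
      derivable_pt_lim (fun s => h (pt s v)) u (E i (pt u v))).
    { intros h E HE. rewrite Epi in HG |- *.
      apply derivable_pt_lim_ext with (f := fun s => h (upd (upd z j v) i s)).
      - intros s. now rewrite Epi.
      - now apply (partials_upd n G). }
    assert (Hj' : forall (h : Pt -> R) E, partials n G h E ->
      derivable_pt_lim (fun s => h (pt u s)) v (E j (pt u v))).
    { intros h E HE. now apply (partials_upd n G). }
    repeat split.
    + now apply Hi'.
    + now apply Hj'.
    + now apply (Hj' (D i) (fun k => H k i)), HH.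
    + now apply (Hi' (D j) (fun k => H k j)), HH.
  - intros eps He. rewrite Ez.
    destruct (HHc j i Hj Hi z Hz eps He) as [d1 [Hd1 H1]].
    destruct (HHc i j Hi Hj z Hz eps He) as [d2 [Hd2 H2]].
    destruct (Hpt (Rmin rho (Rmin d1 d2))) as [d3 [Hd3 H3]].
    { repeat apply Rmin_pos; assumption. }
    exists d3. split; [exact Hd3|]. intros u v Hu Hv. specialize (H3 u v Hu Hv).
    pose proof (Rmin_l rho (Rmin d1 d2)). pose proof (Rmin_r rho (Rmin d1 d2)).
    pose proof (Rmin_l d1 d2). pose proof (Rmin_r d1 d2).
    assert (G (pt u v)) by (apply Hball; lra).
    split; [apply H1 | apply H2]; (assumption || lra).
Qed.

Lemma max_gradient_zero (n : nat) (G : Pt -> Prop) (g : Pt -> R) (D : nat -> Pt -> R) (z : Pt) :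
  gopen n G -> partials n G g D -> G z -> (forall w, G w -> g w <= g z) ->
  forall i, (i < n)%nat -> D i z = 0.
Proof.
  intros HGo HD Hz Hm i Hi. destruct (HGo z Hz) as [rho [Hrho Hball]].
  destruct (dst_lt_of_coords n rho Hrho) as [d [Hd Hdst]].
  apply (interior_max_derivative (fun h => g (upd z i h)) (z i) (D i z) d);
    [now apply HD | exact Hd|].
  intros h Hh. rewrite upd_id. apply Hm, Hball, Hdst. intros k Hk. unfold upd.
  destruct (Nat.eq_dec k i) as [->|].
  - rewrite Rabs_minus_sym. now replace (z i + h - z i) with h by ring.
  - now rewrite Rminus_diag, Rabs_R0.
Qed.

Definition qform (n : nat) (S : nat -> nat -> R) (xi : Pt) : R :=
  sumR n (fun i => sumR n (fun j => S i j * xi i * xi j)).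

(** Restricted to the line through [z] in direction [xi], [g] has a maximum at parameter 0, and its
    second derivative there is the value of the quadratic form. *)
Lemma max_hessian_nonpos (n : nat) (G : Pt -> Prop) (g : Pt -> R)
  (D : nat -> Pt -> R) (H : nat -> nat -> Pt -> R) (z : Pt) :
  gopen n G -> cont_on n G g -> partials n G g D ->
  (forall i, (i < n)%nat -> cont_on n G (D i)) ->
  (forall j, (j < n)%nat -> partials n G (D j) (fun i => H i j)) ->
  (forall i j, (i < n)%nat -> (j < n)%nat -> cont_on n G (H i j)) ->
  G z -> (forall w, G w -> g w <= g z) ->
  forall xi, qform n (fun i j => H i j z) xi <= 0.
Proof.
  intros HGo Hg HD HDc HH HHc Hz Hm b.
  destruct (HGo z Hz) as [rho [Hrho Hball]].
  destruct (box_near n z b rho Hrho) as [d [Hd Hd']].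
  assert (HG : forall s, Rabs s < d -> G (line z b s)).
  { intros s Hs. apply Hball, (Hd' s); [exact Hs|]. intros i Hi. rewrite <- Rabs_mult.
    unfold line. right. f_equal. ring. }
  replace (qform n (fun i j => H i j z) b)
    with (sumR n (fun j => b j * sumR n (fun i => b i * H i j (line z b 0)))).
  - apply (second_derivative_test (fun s => g (line z b s))
      (fun s => sumR n (fun j => b j * D j (line z b s))) _ d Hd).
    + intros s Hs. apply (line_derivative n G); auto.
    + apply (derivable_pt_lim_sumR n (fun j s => b j * D j (line z b s))).
      intros j Hj. apply (derivable_pt_lim_scal (fun s => D j (line z b s))).
      apply (line_derivative n G (D j) (fun i => H i j)); auto.
      apply HG. now rewrite Rabs_R0.
    + intros s Hs. rewrite line_0. auto.
  - unfold qform. rewrite sumR_swap. apply sumR_ext. intros j Hj.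
    rewrite <- sumR_scal. apply sumR_ext. intros i Hi. rewrite line_0. ring.
Qed.

(** * Parabolic comparison principle *)

Lemma dsum_S (n : nat) (F : nat -> nat -> R) :
  sumR (S n) (fun i => sumR (S n) (fun j => F i j)) =
  sumR n (fun i => sumR n (fun j => F i j)) + sumR n (fun i => F i n)
    + sumR n (fun j => F n j) + F n n.
Proof.
  rewrite sumR_S, sumR_S.
  rewrite (sumR_ext n _ (fun i => sumR n (fun j => F i j) + F i n))
    by (intros; apply sumR_S).
  rewrite sumR_plus. ring.
Qed.

Lemma dsum_ext (n : nat) (F H : nat -> nat -> R) :
  (forall i j, (i < n)%nat -> (j < n)%nat -> F i j = H i j) ->
  sumR n (fun i => sumR n (fun j => F i j)) = sumR n (fun i => sumR n (fun j => H i j)).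
Proof. intros E. apply sumR_ext. intros i Hi. apply sumR_ext. auto. Qed.

Lemma dsum_minus_scal (n : nat) (c : R) (F H : nat -> nat -> R) :
  sumR n (fun i => sumR n (fun j => F i j - c * H i j)) =
  sumR n (fun i => sumR n (fun j => F i j)) - c * sumR n (fun i => sumR n (fun j => H i j)).
Proof.
  rewrite (sumR_ext n _ (fun i => sumR n (fun j => F i j) + - c * sumR n (fun j => H i j))).
  - rewrite sumR_plus, sumR_scal. ring.
  - intros i _. rewrite <- sumR_scal, <- sumR_plus. apply sumR_ext. intros; ring.
Qed.

Lemma sumR_mul (n : nat) (F H : nat -> R) :
  sumR n F * sumR n H = sumR n (fun i => sumR n (fun j => F i * H j)).
Proof.
  rewrite Rmult_comm, <- sumR_scal. apply sumR_ext. intros. rewrite sumR_scal. ring.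
Qed.

(* Induction on the size: the Schur complement of the last pivot of [S] is again
   positive definite, and the rank-one remainder contributes a value of the form of [H]. *)
Lemma trace_mul_nonpos (K : R) (HK : 0 < K) (n : nat) : forall S H : nat -> nat -> R,
  (forall i j, (i < n)%nat -> (j < n)%nat -> S i j = S j i) ->
  (forall xi, qform n S xi >= K * sumR n (fun i => xi i ^ 2)) ->
  (forall xi, qform n H xi <= 0) ->
  sumR n (fun i => sumR n (fun j => S i j * H i j)) <= 0.
Proof.
  induction n as [|n IH]; intros S H HS Hpd Hnd; [rewrite sumR_0; lra|].
  set (sg := S n n). set (s := fun i => S i n).
  assert (E : forall xi, qform (Datatypes.S n) S xi =
    qform n S xi + 2 * xi n * sumR n (fun i => s i * xi i) + sg * xi n ^ 2).
  { intros xi. unfold qform at 1. rewrite dsum_S. fold (qform n S xi).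
    rewrite (sumR_ext n (fun j => S n j * xi n * xi j) (fun j => xi n * (s j * xi j)))
      by (intros j Hj; unfold s; rewrite HS by lia; ring).
    rewrite (sumR_ext n (fun i => S i n * xi i * xi n) (fun j => xi n * (s j * xi j)))
      by (intros j Hj; unfold s; ring).
    rewrite !sumR_scal. unfold sg. ring. }
  assert (Hsg : K <= sg).
  (* The last unit vector shows that the pivot is at least [K], hence invertible. *)
  { set (e := upd (fun _ => 0) n 1). specialize (Hpd e). rewrite E in Hpd.
    assert (Ee : forall i, (i < n)%nat -> e i = 0).
    { intros i Hi. unfold e. now rewrite upd_other by lia. }
    rewrite (sumR_ext n (fun i => s i * e i) (fun _ => 0)), sumR_const in Hpd
      by (intros i Hi; rewrite Ee by exact Hi; ring).
    unfold qform in Hpd. rewrite (dsum_ext n _ (fun _ _ => 0)) in Hpd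
      by (intros i j Hi Hj; rewrite Ee by exact Hi; ring).
    rewrite sumR_const, sumR_const, sumR_S, (sumR_ext n _ (fun _ => 0)), sumR_const in Hpd
      by (intros i Hi; rewrite Ee by exact Hi; ring).
    unfold e in Hpd. rewrite upd_same in Hpd. lra. }
  assert (IHs : sumR n (fun i => sumR n (fun j => (S i j - s i * s j / sg) * H i j)) <= 0).
  { apply (IH (fun i j => S i j - s i * s j / sg)).
    - intros i j Hi Hj. rewrite HS by lia. field. lra.
    - intros xi. set (t := sumR n (fun i => s i * xi i)).
      (* The last coordinate [- t / sg] minimises the form of [S] for given [xi]; the minimum is the
         form of the Schur complement. *)
      specialize (Hpd (upd xi n (- t / sg))). rewrite E, sumR_S, upd_same in Hpd.
      rewrite (sumR_ext n (fun i => s i * _) (fun i => s i * xi i)) in Hpd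
        by (intros i Hi; now rewrite upd_other by lia).
      rewrite (sumR_ext n (fun i => upd _ _ _ i ^ 2) (fun i => xi i ^ 2)) in Hpd
        by (intros i Hi; now rewrite upd_other by lia).
      fold t in Hpd.
      replace (qform n S (upd xi n (- t / sg))) with (qform n S xi) in Hpd
        by (apply dsum_ext; intros i j Hi Hj; now rewrite !upd_other by lia).
      replace (qform n (fun i j => S i j - s i * s j / sg) xi)
        with (qform n S xi - / sg * (t * t)).
      + replace (qform n S xi + 2 * (- t / sg) * t + sg * (- t / sg) ^ 2)
          with (qform n S xi - / sg * (t * t)) in Hpd by (field; lra).
        pose proof (pow2_ge_0 (- t / sg)). nra.
      + unfold t. rewrite sumR_mul. unfold qform. rewrite <- dsum_minus_scal.
        apply dsum_ext. intros. field. lra.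
    - intros xi. specialize (Hnd (upd xi n 0)). unfold qform in Hnd at 1.
      rewrite dsum_S, upd_same in Hnd.
      rewrite (dsum_ext n _ (fun i j => H i j * xi i * xi j)) in Hnd
        by (intros; now rewrite !upd_other by lia).
      rewrite (sumR_ext n (fun i => H i n * upd xi n 0 i * 0) (fun _ => 0)),
        (sumR_ext n (fun j => H n j * 0 * upd xi n 0 j) (fun _ => 0)),
        sumR_const in Hnd by (intros; ring).
      unfold qform. lra. }
  (* The test vector is the last column of [S], whose last entry is [sg]: divided by [sg], the form
     of [H] at it is exactly what the Schur complement leaves out of the trace. *)
  specialize (Hnd s). unfold qform in Hnd. rewrite dsum_S in Hnd.
  rewrite dsum_S.
  rewrite (dsum_ext n (fun i j => (S i j - s i * s j / sg) * H i j)
    (fun i j => S i j * H i j - / sg * (H i j * s i * s j))) in IHs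
    by (intros; field; lra).
  rewrite dsum_minus_scal in IHs.
  rewrite (sumR_ext n (fun j => H n j * s n * s j) (fun j => sg * (S n j * H n j))) in Hnd
    by (intros j Hj; unfold s, sg; rewrite (HS n j) by lia; ring).
  rewrite (sumR_ext n (fun i => H i n * s i * s n) (fun i => sg * (S i n * H i n))) in Hnd
    by (intros i Hi; unfold s, sg; ring).
  rewrite !sumR_scal in Hnd.
  set (Q := sumR n (fun i => sumR n (fun j => H i j * s i * s j))) in *.
  set (P := sumR n (fun i => sumR n (fun j => S i j * H i j))) in *.
  set (u := sumR n (fun i => S i n * H i n)) in *.
  set (v := sumR n (fun j => S n j * H n j)) in *.
  change (S n n) with sg. change (s n) with sg in Hnd.
  assert (Hq : / sg * (Q + sg * u + sg * v + H n n * sg * sg) <= 0).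
  { assert (0 < / sg) by (apply Rinv_0_lt_compat; lra). nra. }
  replace (/ sg * (Q + sg * u + sg * v + H n n * sg * sg))
    with (/ sg * Q + u + v + sg * H n n) in Hq by (field; lra).
  lra.
Qed.

(** Pairing with a symmetric matrix sees only the symmetric part of [S]. This applies to [H] and
    also to the products [xi i * xi j], so ellipticity passes to the symmetric part. *)
Lemma trace_mul_nonpos_nonsym (K : R) (n : nat) (S H : nat -> nat -> R) :
  0 < K ->
  (forall i j, (i < n)%nat -> (j < n)%nat -> H i j = H j i) ->
  (forall xi, qform n S xi >= K * sumR n (fun i => xi i ^ 2)) ->
  (forall xi, qform n H xi <= 0) ->
  sumR n (fun i => sumR n (fun j => S i j * H i j)) <= 0.
Proof.
  intros HK HH Hpd Hnd.
  assert (Esym : forall H' : nat -> nat -> R,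
    (forall i j, (i < n)%nat -> (j < n)%nat -> H' i j = H' j i) ->
    sumR n (fun i => sumR n (fun j => (S i j + S j i) / 2 * H' i j)) =
    sumR n (fun i => sumR n (fun j => S i j * H' i j))).
  { intros H' HH'.
    transitivity (sumR n (fun i => sumR n (fun j => S i j / 2 * H' i j)) +
      sumR n (fun i => sumR n (fun j => S j i / 2 * H' j i))).
    - rewrite <- sumR_plus. apply sumR_ext. intros i Hi. rewrite <- sumR_plus.
      apply sumR_ext. intros j Hj. rewrite (HH' j i) by assumption. lra.
    - rewrite (sumR_swap n n (fun i j => S j i / 2 * H' j i)), <- sumR_plus.
      apply sumR_ext. intros i Hi. rewrite <- sumR_plus. apply sumR_ext. intros; lra. }
  rewrite <- (Esym H HH). apply (trace_mul_nonpos K HK).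
  - intros; lra.
  - intros xi. specialize (Hpd xi). unfold qform in *.
    rewrite (dsum_ext n (fun i j => (S i j + S j i) / 2 * xi i * xi j)
      (fun i j => (S i j + S j i) / 2 * (xi i * xi j))) by (intros; ring).
    rewrite (Esym (fun i j => xi i * xi j)) by (intros; ring).
    rewrite (dsum_ext n (fun i j => S i j * (xi i * xi j)) (fun i j => S i j * xi i * xi j))
      by (intros; ring). exact Hpd.
  - exact Hnd.
Qed.

Lemma cont2_on_exp_diff (n : nat) (S S' : R -> Pt -> Prop) (k : R) (x y : R -> Pt -> R) :
  (forall t z, S' t z -> S t z) -> cont2_on n S x -> cont2_on n S y ->
  cont2_on n S' (fun t z => exp (- k * t) * (x t z - y t z)).
Proof.
  intros HS Hx Hy t z Hz eps He. apply HS in Hz.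
  assert (Hexp : continuity_pt (fun s => exp (- k * s)) t).
  { apply derivable_continuous_pt. exists (exp (- k * t) * (- k * 1)).
    apply (derivable_pt_lim_comp (fun s => - k * s) exp).
    - apply (derivable_pt_lim_scal id), derivable_pt_lim_id.
    - apply derivable_pt_lim_exp. }
  set (a := Rabs (x t z - y t z)). set (b := exp (- k * t)).
  assert (Ha : 0 <= a) by apply Rabs_pos. assert (Hb : 0 < b) by apply exp_pos.
  (* The bound 1 keeps the nearby exponential below [b + 1]; the two terms of the product difference
     get [eps / 2] each. *)
  set (e1 := Rmin 1 (eps / 2 / (a + 1))).
  set (e2 := eps / 2 / (b + 1)).
  assert (He1 : 0 < e1).
  { apply Rmin_pos; [lra|]. apply Rdiv_lt_0_compat; lra. }
  assert (He2 : 0 < e2) by (apply Rdiv_lt_0_compat; lra).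
  assert (He1' : e1 <= 1) by apply Rmin_l.
  assert (He1a : e1 * (a + 1) <= eps / 2).
  { apply Rle_trans with (eps / 2 / (a + 1) * (a + 1)); [|right; field; lra].
    apply Rmult_le_compat_r; [lra | apply Rmin_r]. }
  assert (He2b : e2 * (b + 1) = eps / 2) by (unfold e2; field; lra).
  destruct (Hexp e1 He1) as [d1 [Hd1 H1]].
  destruct (Hx t z Hz (e2 / 2) ltac:(lra)) as [d2 [Hd2 H2]].
  destruct (Hy t z Hz (e2 / 2) ltac:(lra)) as [d3 [Hd3 H3]].
  exists (Rmin d1 (Rmin d2 d3)). split; [repeat apply Rmin_pos; assumption|].
  intros s w Hw Hd. apply HS in Hw.
  pose proof (Rmin_l d1 (Rmin d2 d3)). pose proof (Rmin_r d1 (Rmin d2 d3)).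
  pose proof (Rmin_l d2 d3). pose proof (Rmin_r d2 d3).
  specialize (H2 s w Hw ltac:(lra)). specialize (H3 s w Hw ltac:(lra)).
  assert (H1' : Rabs (exp (- k * s) - b) < e1).
  { destruct (Req_dec s t) as [->|ne].
    - unfold b. rewrite Rminus_diag, Rabs_R0. exact He1.
    - apply (H1 s). split; [split; [exact I | congruence]|].
      simpl. unfold Rdist. pose proof (Rmax_l (Rabs (s - t)) (dst n z w)). lra. }
  set (q := (x s w - y s w) - (x t z - y t z)).
  assert (Hq : Rabs q < e2).
  { unfold q. apply Rabs_def2 in H2, H3. apply Rabs_def1; lra. }
  replace (exp (- k * s) * (x s w - y s w) - b * (x t z - y t z))
    with ((exp (- k * s) - b) * (x t z - y t z) + (b + (exp (- k * s) - b)) * q)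
    by (unfold q; ring).
  apply Rle_lt_trans with (1 := Rabs_triang _ _). rewrite !Rabs_mult. fold a.
  assert (Hbe : Rabs (b + (exp (- k * s) - b)) <= b + 1).
  { apply Rabs_def2 in H1'. apply Rabs_le. lra. }
  assert (Rabs (exp (- k * s) - b) * a <= e1 * a) by (apply Rmult_le_compat_r; lra).
  assert (Rabs (b + (exp (- k * s) - b)) * Rabs q <= (b + 1) * Rabs q)
    by (apply Rmult_le_compat_r; [apply Rabs_pos | exact Hbe]).
  assert ((b + 1) * Rabs q < (b + 1) * e2) by (apply Rmult_lt_compat_l; lra).
  lra.
Qed.

Lemma cont2_on_sub (n : nat) (S S' : R -> Pt -> Prop) (x : R -> Pt -> R) :
  (forall t z, S' t z -> S t z) -> cont2_on n S x -> cont2_on n S' x.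
Proof.
  intros HS Hx t z Hz eps He. destruct (Hx t z (HS t z Hz) eps He) as [d [Hd H]].
  exists d. split; [exact Hd|]. auto.
Qed.

Lemma cont2_on_abs (n : nat) (S : R -> Pt -> Prop) (x : R -> Pt -> R) :
  cont2_on n S x -> cont2_on n S (fun t z => Rabs (x t z)).
Proof.
  intros Hx t z Hz eps He. destruct (Hx t z Hz eps He) as [d [Hd H]].
  exists d. split; [exact Hd|]. intros s w Hw Hdw.
  apply Rle_lt_trans with (1 := Rabs_triang_inv2 _ _). auto.
Qed.

(* At a positive maximum of [exp (- k t) (x - x')] over a compact cylinder, with [k] the
   one-sided Lipschitz constant of [f] on the range of [x] and [x'], the equation would
   make the time derivative negative. *)
Lemma comparison_principle (n : nat) (G : Pt -> Prop) (A : nat -> nat -> Pt -> R)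
  (f : Pt -> R -> Pt -> R) (x0 x0' : Pt -> R) (u u' x x' : R -> Pt -> R) :
  gopen n G -> gbounded n G -> cont_f n G f ->
  (exists K, 0 < K /\ forall z xi, clos n G z ->
     sumR n (fun i => sumR n (fun j => A i j z * xi i * xi j))
       >= K * sumR n (fun i => xi i ^ 2)) ->
  (forall W : R -> Prop, (exists B, forall w, W w -> Rabs w <= B) ->
     exists k, 0 < k /\ forall w1 w2 z xi, W w1 -> W w2 -> w2 < w1 -> G z ->
       f z w1 xi - f z w2 xi < k * (w1 - w2)) ->
  is_sol n G A f x0 u x -> is_sol n G A f x0' u' x' ->
  (forall z, G z -> x0 z <= x0' z) ->
  (forall t z, 0 <= t -> bdry n G z -> u t z <= u' t z) ->
  forall t z, 0 <= t -> clos n G z -> x t z <= x' t z.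
Proof.
  intros HGo HG Hf [K [HK Hpar]] Hlip [Cx [[dt [D1 [D2 [Hdt [HD1 [HD2 [_ [CD1 [CD2 Heq]]]]]]]]]
    [Ix Bx]]] [Cx' [[dt' [D1' [D2' [Hdt' [HD1' [HD2' [_ [CD1' [CD2' Heq']]]]]]]]] [Ix' Bx']]]
    H0 Hu T z1 HT Hz1.
  apply Rnot_lt_le. intros Hlt.
  assert (Hsub : forall t z, cyl n G T t z -> 0 <= t /\ clos n G z).
  { intros t z [Ht Hz]. split; [lra | exact Hz]. }
  destruct (cyl_bounded_above n G T (fun t z => Rabs (x t z)) HG) as [B HB].
  { now apply cont2_on_abs, (cont2_on_sub n _ _ x Hsub). }
  destruct (cyl_bounded_above n G T (fun t z => Rabs (x' t z)) HG) as [B' HB'].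
  { now apply cont2_on_abs, (cont2_on_sub n _ _ x' Hsub). }
  (* A single [k] must serve the values of both solutions on the cylinder that ends at the time [T]
     of the supposed violation. *)
  destruct (Hlip (fun w => Rabs w <= Rmax B B')) as [k [Hk Hfk]]; [now exists (Rmax B B')|].
  destruct (cyl_max n G T (fun t z => exp (- k * t) * (x t z - x' t z)) T z1 HG)
    as [t0 [z0 [[Ht0 Hz0] Hmax]]].
  { now apply (cont2_on_exp_diff n (fun t z => 0 <= t /\ clos n G z)). }
  { split; [lra | exact Hz1]. }
  assert (Hpos : 0 < x t0 z0 - x' t0 z0).
  { assert (H1 : 0 < exp (- k * T) * (x T z1 - x' T z1)).
    { apply Rmult_lt_0_compat; [apply exp_pos | lra]. }
    pose proof (Hmax T z1 ltac:(split; [lra | exact Hz1])) as H2.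
    pose proof (exp_pos (- k * t0)). apply Rnot_le_lt. intros H3. nra. }
  (* On the lateral boundary and at time 0 the data give [x <= x'], so the positive maximum lies
     over [G] and at a positive time. *)
  assert (HGz : G z0).
  { apply NNPP. intros Hn. assert (Hb : bdry n G z0) by (split; assumption).
    rewrite Bx, Bx' in Hpos by (assumption || lra).
    specialize (Hu t0 z0 ltac:(lra) Hb). lra. }
  assert (Ht0' : 0 < t0).
  { destruct (Rle_lt_or_eq_dec 0 t0) as [|E]; [lra|assumption|]. rewrite <- E in Hpos.
    rewrite Ix, Ix' in Hpos by assumption. specialize (H0 z0 HGz). lra. }
  set (g := fun z => x t0 z - x' t0 z).
  set (D := fun i z => D1 i t0 z - D1' i t0 z).
  set (H := fun i j z => D2 i j t0 z - D2' i j t0 z).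
  assert (Hslice : forall y, cont2_on n (fun t z => 0 < t /\ G z) y -> cont_on n G (y t0)).
  { intros y. apply cont2_on_slice. intros z Hz. now split. }
  assert (Hslice' : forall y, cont2_on n (fun t z => 0 <= t /\ clos n G z) y -> cont_on n G (y t0)).
  { intros y. apply cont2_on_slice. intros z Hz. split; [lra | now apply clos_sub]. }
  assert (Pg : partials n G g D).
  { intros i z Hi Hz. apply derivable_pt_lim_minus; auto. }
  assert (Cg : cont_on n G g) by (apply cont_on_minus; auto).
  assert (CD : forall i, (i < n)%nat -> cont_on n G (D i)).
  { intros i Hi. apply cont_on_minus; auto. }
  assert (PD : forall j, (j < n)%nat -> partials n G (D j) (fun i => H i j)).
  { intros j Hj i z Hi Hz. apply derivable_pt_lim_minus; auto. }
  assert (CH : forall i j, (i < n)%nat -> (j < n)%nat -> cont_on n G (H i j)).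
  { intros i j Hi Hj. apply cont_on_minus; auto. }
  assert (Mg : forall w, G w -> g w <= g z0).
  { intros w Hw. apply Rmult_le_reg_l with (exp (- k * t0)); [apply exp_pos|].
    apply (Hmax t0 w). split; [exact Ht0 | now apply clos_sub]. }
  assert (Htr : sumR n (fun i => sumR n (fun j => A i j z0 * H i j z0)) <= 0).
  { apply (trace_mul_nonpos_nonsym K n (fun i j => A i j z0) (fun i j => H i j z0) HK).
    - intros i j Hi Hj. now apply (second_partials_sym n G g D H).
    - intros xi. now apply Hpar.
    - now apply (max_hessian_nonpos n G g D H). }
  pose proof (max_gradient_zero n G g D z0 HGo Pg HGz Mg) as Hgrad.
  (* The gradients coincide in the first [n] coordinates only, that is, up to distance 0; continuity
     of [f] does the rest. *)
  assert (Ef : f z0 (x' t0 z0) (fun i => D1' i t0 z0) = f z0 (x' t0 z0) (fun i => D1 i t0 z0)).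
  { apply cond_eq. intros eps He.
    destruct (Hf z0 (x' t0 z0) (fun i => D1 i t0 z0) Hz0 eps He) as [d [Hd H']].
    apply H'; [exact Hz0|]. rewrite Rminus_diag, Rabs_R0, !dst_eq0.
    - repeat apply Rmax_lub_lt; lra.
    - intros i Hi. specialize (Hgrad i Hi). unfold D in Hgrad. lra.
    - reflexivity. }
  assert (Hc0 : cyl n G T t0 z0) by (split; assumption).
  specialize (Hfk (x t0 z0) (x' t0 z0) z0 (fun i => D1 i t0 z0)
    (Rle_trans _ _ _ (HB t0 z0 Hc0) (Rmax_l _ _))
    (Rle_trans _ _ _ (HB' t0 z0 Hc0) (Rmax_r _ _)) ltac:(lra) HGz).
  specialize (Heq t0 z0 Ht0' HGz). specialize (Heq' t0 z0 Ht0' HGz). rewrite Ef in Heq'.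
  assert (Htr' : sumR n (fun i => sumR n (fun j => A i j z0 * D2 i j t0 z0)) -
    1 * sumR n (fun i => sumR n (fun j => A i j z0 * D2' i j t0 z0)) <= 0).
  { rewrite <- dsum_minus_scal. rewrite (dsum_ext n _ (fun i j => A i j z0 * H i j z0)).
    - exact Htr.
    - intros. unfold H. ring. }
  assert (Hder : derivable_pt_lim (fun s => exp (- k * s) * (x s z0 - x' s z0)) t0
    (exp (- k * t0) * (- k * 1) * (x t0 z0 - x' t0 z0) +
     exp (- k * t0) * (dt t0 z0 - dt' t0 z0))).
  { apply (derivable_pt_lim_mult (fun s => exp (- k * s)) (fun s => x s z0 - x' s z0)).
    - apply (derivable_pt_lim_comp (fun s => - k * s) exp).
      + apply (derivable_pt_lim_scal id), derivable_pt_lim_id.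
      + apply derivable_pt_lim_exp.
    - apply derivable_pt_lim_minus; auto. }
  apply (left_max_derivative_nonneg _ _ _ t0) in Hder; [|exact Ht0'|].
  - pose proof (exp_pos (- k * t0)). set (e := exp (- k * t0)) in *.
    assert (0 <= e * (dt t0 z0 - dt' t0 z0 - k * (x t0 z0 - x' t0 z0))) by lra.
    assert (dt t0 z0 - dt' t0 z0 - k * (x t0 z0 - x' t0 z0) < 0) by lra.
    nra.
  - intros h Hh. apply (Hmax (t0 - h) z0). split; [lra | exact Hz0].
Qed.

(** * Suprema, powers and lower sums *)

Lemma Rsup_ub (E : R -> Prop) (b r : R) : (forall s, E s -> s <= b) -> E r -> r <= Rsup E.
Proof.
  intros Hb Hr. unfold Rsup. destruct (excluded_middle_informative _) as [H|H].
  - destruct (constructive_indefinite_description _ H) as [l Hl]. simpl. now apply Hl.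
  - destruct H. destruct (completeness E) as [l Hl]; [now exists b | now exists r | now exists l].
Qed.

(** The condition [0 <= b] covers the default value 0 of [Rsup]. *)
Lemma Rsup_le (E : R -> Prop) (b : R) : 0 <= b -> (forall s, E s -> s <= b) -> Rsup E <= b.
Proof.
  intros H0 Hb. unfold Rsup. destruct (excluded_middle_informative _) as [H|H]; [|exact H0].
  destruct (constructive_indefinite_description _ H) as [l Hl]. simpl. now apply Hl.
Qed.

Lemma Rsup_nonneg (E : R -> Prop) : E 0 -> 0 <= Rsup E.
Proof.
  intros HE. unfold Rsup. destruct (excluded_middle_informative _) as [H|H]; [|lra].
  destruct (constructive_indefinite_description _ H) as [l Hl]. simpl. now apply Hl.
Qed.

Lemma rpow_nonneg (a s : R) : 0 <= rpow a s.
Proof. unfold rpow. destruct (Rle_dec a 0); [lra|]. left. apply exp_pos. Qed.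

Lemma rpow_le (a b s : R) : 0 <= s -> a <= b -> rpow a s <= rpow b s.
Proof.
  intros Hs Hab. unfold rpow at 1. destruct (Rle_dec a 0); [apply rpow_nonneg|].
  unfold rpow. destruct (Rle_dec b 0); [lra|]. apply Rle_Rpower_l; lra.
Qed.

Lemma rpow_mult (a b s : R) : 0 <= a -> 0 <= b -> rpow (a * b) s = rpow a s * rpow b s.
Proof.
  intros Ha Hb. unfold rpow.
  destruct (Rle_dec a 0) as [Ha'|Ha'].
  { replace a with 0 by lra. rewrite Rmult_0_l. destruct (Rle_dec 0 0); lra. }
  destruct (Rle_dec b 0) as [Hb'|Hb'].
  { replace b with 0 by lra. rewrite Rmult_0_r. destruct (Rle_dec 0 0); lra. }
  destruct (Rle_dec (a * b) 0); [nra|]. symmetry. apply Rpower_mult_distr; lra.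
Qed.

Lemma rpow_rpow_inv (a s : R) : 0 < s -> 0 <= a -> rpow (rpow a s) (/ s) = a.
Proof.
  intros Hs Ha. unfold rpow at 2. destruct (Rle_dec a 0).
  { unfold rpow. destruct (Rle_dec 0 0); lra. }
  unfold rpow. destruct (Rle_dec (Rpower a s) 0) as [H|_].
  { pose proof (exp_pos (s * ln a)). unfold Rpower in H. lra. }
  rewrite Rpower_mult, Rinv_r, Rpower_1; lra.
Qed.

Lemma rpow_inv_rpow (a s : R) : 0 < s -> 0 <= a -> rpow (rpow a (/ s)) s = a.
Proof.
  intros Hs Ha. rewrite <- (Rinv_inv s) at 2. apply rpow_rpow_inv; [|exact Ha].
  now apply Rinv_0_lt_compat.
Qed.

(** The sum is at most twice the larger term, and [2 ^ s <= 2]. It is applied with [s = / q]. *)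
Lemma rpow_add_le (a b s : R) : 0 <= s <= 1 -> 0 <= a -> 0 <= b ->
  rpow (a + b) s <= 2 * (rpow a s + rpow b s).
Proof.
  intros Hs Ha Hb.
  assert (H2 : rpow 2 s <= 2).
  { unfold rpow. destruct (Rle_dec 2 0); [lra|].
    apply Rle_trans with (Rpower 2 1); [apply Rle_Rpower; lra | rewrite Rpower_1; lra]. }
  pose proof (rpow_nonneg a s). pose proof (rpow_nonneg b s).
  destruct (Rle_dec a b).
  - apply Rle_trans with (rpow (2 * b) s); [apply rpow_le; lra|].
    rewrite rpow_mult by lra. nra.
  - apply Rle_trans with (rpow (2 * a) s); [apply rpow_le; lra|].
    rewrite rpow_mult by lra. nra.
Qed.

Definition corner (k : nat) (m : list Z) : Pt := fun i => IZR (nth i m 0%Z) / 2 ^ k.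

Lemma corner_in_cube (n k : nat) (m : list Z) : dyadic_cube n k m (corner k m).
Proof.
  intros i _. unfold corner, Rdiv. assert (0 < / 2 ^ k) by (apply Rinv_0_lt_compat, pow_lt; lra).
  split; [lra|]. apply Rmult_le_compat_r; lra.
Qed.

Fixpoint int_lists (N n : nat) : list (list Z) :=
  match n with
  | O => nil :: nil
  | S n => map (fun al => fst al :: snd al)
      (list_prod (map (fun i => Z.of_nat i - Z.of_nat N)%Z (seq 0 (2 * N + 1))) (int_lists N n))
  end%list.

Lemma int_lists_length (N n : nat) : length (int_lists N n) = ((2 * N + 1) ^ n)%nat.
Proof.
  induction n as [|n IH]; [reflexivity|].
  cbn [int_lists]. rewrite length_map, length_prod, length_map, length_seq, IH. reflexivity.
Qed.

Lemma in_int_lists (N n : nat) : forall m, length m = n ->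
  (forall i, (i < n)%nat -> (Z.abs (nth i m 0) <= Z.of_nat N)%Z) -> In m (int_lists N n).
Proof.
  induction n as [|n IH]; intros [|a m] Hl Hm; try discriminate; [now left|].
  cbn [int_lists]. apply in_map_iff. exists (a, m). split; [reflexivity|].
  apply in_prod.
  - apply in_map_iff. exists (Z.to_nat (a + Z.of_nat N)).
    specialize (Hm O ltac:(lia)). simpl in Hm.
    split; [lia|]. apply in_seq. lia.
  - apply IH; [now injection Hl|]. intros i Hi. apply (Hm (S i)). lia.
Qed.

(** The lowest corner of each cube lies in [G], so the index entries are at most [N] in absolute
    value, with [N <= B * 2 ^ k + 1]. There are at most [(2 N + 1) ^ n] such indices, and
    [2 N + 1 <= (2 B + 3) * 2 ^ k] because [1 <= 2 ^ k]. *)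
Lemma cubes_volume_bounded (n : nat) (G : Pt -> Prop) : gbounded n G ->
  exists V, 0 <= V /\ forall (k : nat) (L : list (list Z)), NoDup L ->
    (forall m, In m L -> length m = n /\ forall z, dyadic_cube n k m z -> G z) ->
    INR (length L) * (/ 2) ^ (k * n) <= V.
Proof.
  intros [B0 HB0]. set (B := Rmax B0 0).
  assert (HB : 0 <= B) by apply Rmax_r.
  exists ((2 * B + 3) ^ n). split; [apply pow_le; lra|].
  intros k L HL HG.
  assert (H2k : 1 <= 2 ^ k) by (apply pow_R1_Rle; lra).
  assert (HN : exists N : nat, B * 2 ^ k <= INR N <= B * 2 ^ k + 1).
  { destruct (archimed (B * 2 ^ k)) as [H1 H2].
    destruct (IZN (up (B * 2 ^ k))) as [N E]; [apply le_IZR; nra|].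
    exists N. rewrite INR_IZR_INZ, <- E. lra. }
  destruct HN as [N [HN1 HN2]].
  assert (Hlen : (length L <= (2 * N + 1) ^ n)%nat).
  { rewrite <- int_lists_length. apply NoDup_incl_length; [exact HL|].
    intros m Hm. destruct (HG m Hm) as [Hl Hc]. apply in_int_lists; [exact Hl|].
    intros i Hi. apply le_IZR. rewrite abs_IZR, <- INR_IZR_INZ.
    specialize (HB0 _ (Hc _ (corner_in_cube n k m))).
    pose proof (coord_le_dst n i (corner k m) (fun _ => 0) Hi) as Hd.
    rewrite Rminus_0_r in Hd. unfold corner in Hd at 1. unfold Rdiv in Hd.
    rewrite Rabs_mult, Rabs_inv, (Rabs_right (2 ^ k)) in Hd by lra.
    apply Rle_trans with (2 := HN1).
    replace (Rabs (IZR (nth i m 0%Z))) with (Rabs (IZR (nth i m 0%Z)) * / 2 ^ k * 2 ^ k)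
      by (field; lra).
    apply Rmult_le_compat_r; [lra|]. pose proof (Rmax_l B0 0). fold B in H. lra. }
  apply le_INR in Hlen. rewrite pow_INR in Hlen.
  rewrite plus_INR, mult_INR in Hlen. simpl (INR 2) in Hlen. simpl (INR 1) in Hlen.
  assert (Hi : 0 < (/ 2) ^ k) by (apply pow_lt; lra).
  assert (Ei : (/ 2) ^ k * 2 ^ k = 1).
  { rewrite <- Rpow_mult_distr, Rinv_l, pow1; lra. }
  rewrite pow_mult. apply Rle_trans with (((2 * INR N + 1) * (/ 2) ^ k) ^ n).
  - rewrite Rpow_mult_distr. apply Rmult_le_compat_r; [apply pow_le; lra|].
    replace (2 * INR N + 1) with ((1 + 1) * INR N + 1) by ring. exact Hlen.
  - apply pow_incr. pose proof (pos_INR N). split; [nra|].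
    apply Rle_trans with (((2 * B + 3) * 2 ^ k) * (/ 2) ^ k); [|right].
    + apply Rmult_le_compat_r; [lra|]. nra.
    + rewrite Rmult_assoc, (Rmult_comm (2 ^ k)), Ei. ring.
Qed.

(** The part of [lower_sums] that passes to sublists, separated from distinctness so that the
    families can be treated by induction. *)
Definition under (n : nat) (G : Pt -> Prop) (k : nat) (phi : Pt -> R)
  (L : list (list Z * R)) : Prop :=
  forall m c, In (m, c) L -> length m = n /\ 0 <= c /\
    forall z, dyadic_cube n k m z -> G z /\ c <= phi z.

Definition lsum (v : R) (L : list (list Z * R)) : R :=
  fold_right (fun mc acc => snd mc * v + acc) 0 L.

(** Only the heights change from cube to cube; the cubes stay the same, so distinctness carries over
    to both new families. The error [e] is paid once per cube, hence the factor total volume. *)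
Lemma lsum_split (n : nat) (G : Pt -> Prop) (k : nat) (phi phi1 phi2 : Pt -> R) (a e v : R)
  (L : list (list Z * R)) :
  0 <= v ->
  (forall m c, 0 <= c -> (forall z, dyadic_cube n k m z -> G z /\ c <= phi z) ->
    exists c1 c2, 0 <= c1 /\ 0 <= c2 /\
      (forall z, dyadic_cube n k m z -> c1 <= phi1 z /\ c2 <= phi2 z) /\
      c <= a * (c1 + c2) + e) ->
  under n G k phi L ->
  exists L1 L2, map fst L1 = map fst L /\ map fst L2 = map fst L /\
    under n G k phi1 L1 /\ under n G k phi2 L2 /\
    lsum v L <= a * (lsum v L1 + lsum v L2) + e * (INR (length L) * v).
Proof.
  intros Hv Hc. induction L as [|[m c] L IH]; intros HL.
  - exists nil, nil. repeat split; try (intros ? ? []); try easy. simpl. lra.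
  - destruct IH as [L1 [L2 [E1 [E2 [U1 [U2 Hs]]]]]].
    { intros m' c' H'. apply HL. now right. }
    destruct (HL m c (or_introl eq_refl)) as [Hl [Hc0 Hz]].
    destruct (Hc m c Hc0 Hz) as [c1 [c2 [Hc1 [Hc2 [Hz' Hcc]]]]].
    exists ((m, c1) :: L1), ((m, c2) :: L2).
    split; [simpl; now rewrite E1|]. split; [simpl; now rewrite E2|].
    split; [|split].
    + intros m' c' [H|H]; [|now apply U1]. injection H as <- <-.
      split; [exact Hl|]. split; [exact Hc1|]. intros z H. split; [now apply Hz | now apply Hz'].
    + intros m' c' [H|H]; [|now apply U2]. injection H as <- <-.
      split; [exact Hl|]. split; [exact Hc2|]. intros z H. split; [now apply Hz | now apply Hz'].
    + assert (c * v <= (a * (c1 + c2) + e) * v) by (apply Rmult_le_compat_r; assumption).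
      cbn [length]. rewrite S_INR. simpl. lra.
Qed.

Lemma under_cubes (n : nat) (G : Pt -> Prop) (k : nat) (phi : Pt -> R) (L : list (list Z * R)) :
  under n G k phi L -> forall m, In m (map fst L) ->
  length m = n /\ forall z, dyadic_cube n k m z -> G z.
Proof.
  intros HL m Hm. apply in_map_iff in Hm. destruct Hm as [[m' c] [<- Hm]].
  destruct (HL m' c Hm) as [Hl [_ Hz]]. split; [exact Hl|]. intros z H. now apply Hz.
Qed.

Lemma ginteg_nonneg (n : nat) (G : Pt -> Prop) (phi : Pt -> R) : 0 <= ginteg n G phi.
Proof.
  apply Rsup_nonneg. exists O, nil. split; [constructor|]. split; [intros ? ? []|reflexivity].
Qed.

(** The bound [b] on [phi] and the bound on the total volume make [ginteg] a genuine supremum rather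
    than the default 0. *)
Lemma lsum_le_ginteg (n : nat) (G : Pt -> Prop) (phi : Pt -> R) (b : R)
  (k : nat) (L : list (list Z * R)) :
  gbounded n G -> (forall z, G z -> phi z <= b) -> NoDup (map fst L) -> under n G k phi L ->
  lsum ((/ 2) ^ (k * n)) L <= ginteg n G phi.
Proof.
  intros HG Hb HL HU. destruct (cubes_volume_bounded n G HG) as [V [HV Hcount]].
  apply Rsup_ub with (b := Rmax b 0 * V); [|now exists k, L].
  intros s [k' [L' [HN [HU' ->]]]].
  specialize (Hcount k' _ HN (under_cubes n G k' phi L' HU')). rewrite length_map in Hcount.
  assert (Hv : 0 < (/ 2) ^ (k' * n)) by (apply pow_lt; lra).
  set (v := (/ 2) ^ (k' * n)) in *.
  apply Rle_trans with (Rmax b 0 * (INR (length L') * v)).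
  - clear HN Hcount. induction L' as [|[m c] L' IH]; [simpl; lra|].
    cbn [length]. rewrite S_INR. simpl.
    destruct (HU' m c (or_introl eq_refl)) as [_ [_ Hz]].
    destruct (Hz _ (corner_in_cube n k' m)) as [Hz1 Hz2]. apply Hb in Hz1.
    pose proof (Rmax_l b 0).
    assert (c * v <= Rmax b 0 * v) by (apply Rmult_le_compat_r; lra).
    assert (IH' := IH (fun m' c' H' => HU' m' c' (or_intror H'))). lra.
  - apply Rmult_le_compat_l; [apply Rmax_r | exact Hcount].
Qed.

Lemma ginteg_split (n : nat) (G : Pt -> Prop) : gbounded n G ->
  exists V, 0 <= V /\ forall (phi phi1 phi2 : Pt -> R) (a e b : R), 0 <= a -> 0 <= e ->
  (forall z, G z -> phi1 z <= b) -> (forall z, G z -> phi2 z <= b) ->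
  (forall k m c, 0 <= c -> (forall z, dyadic_cube n k m z -> G z /\ c <= phi z) ->
    exists c1 c2, 0 <= c1 /\ 0 <= c2 /\
      (forall z, dyadic_cube n k m z -> c1 <= phi1 z /\ c2 <= phi2 z) /\
      c <= a * (c1 + c2) + e) ->
  ginteg n G phi <= a * (ginteg n G phi1 + ginteg n G phi2) + e * V.
Proof.
  intros HG. destruct (cubes_volume_bounded n G HG) as [V [HV Hcount]].
  exists V. split; [exact HV|]. intros phi phi1 phi2 a e b Ha He Hb1 Hb2 Hc.
  pose proof (ginteg_nonneg n G phi1). pose proof (ginteg_nonneg n G phi2).
  apply Rsup_le.
  { apply Rplus_le_le_0_compat; apply Rmult_le_pos; lra. }
  intros s [k [L [HN [HU ->]]]].
  assert (Hv : 0 < (/ 2) ^ (k * n)) by (apply pow_lt; lra).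
  destruct (lsum_split n G k phi phi1 phi2 a e ((/ 2) ^ (k * n)) L)
    as [L1 [L2 [E1 [E2 [U1 [U2 Hs]]]]]]; [lra | apply Hc | exact HU|].
  apply Rle_trans with (1 := Hs).
  specialize (Hcount k _ HN (under_cubes n G k phi L HU)). rewrite length_map in Hcount.
  apply Rplus_le_compat; apply Rmult_le_compat_l; try assumption.
  apply Rplus_le_compat; apply (lsum_le_ginteg n G _ b); try assumption.
  - now rewrite E1.
  - now rewrite E2.
Qed.

(** * Quasi-norm estimates *)

(** Extends a segment to all real parameters without leaving the cube, so that the intermediate
    value theorem meets a function continuous on the whole line. *)
Definition clamp (s : R) : R := Rmax 0 (Rmin 1 s).

Lemma clamp_lip (s t : R) : Rabs (clamp s - clamp t) <= Rabs (s - t).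
Proof.
  unfold clamp, Rmax, Rmin, Rabs.
  repeat destruct Rle_dec; repeat destruct Rcase_abs; lra.
Qed.

Lemma clamp_range (s : R) : 0 <= clamp s <= 1.
Proof. unfold clamp, Rmax, Rmin. repeat destruct Rle_dec; lra. Qed.

(** If both alternatives failed, [y] would change sign along a segment in the convex cube and vanish
    somewhere on it, against [0 < c <= Rabs (y z)]. *)
Lemma cube_constant_sign (n : nat) (G : Pt -> Prop) (y : Pt -> R) (k : nat) (m : list Z) (c : R) :
  cont_on n G y -> 0 < c ->
  (forall z, dyadic_cube n k m z -> G z /\ c <= Rabs (y z)) ->
  (forall z, dyadic_cube n k m z -> c <= y z) \/
  (forall z, dyadic_cube n k m z -> c <= - y z).
Proof.
  intros Hy Hc Hcube. apply NNPP. intros Hno. apply not_or_and in Hno.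
  destruct Hno as [N1 N2].
  apply not_all_ex_not in N1, N2. destruct N1 as [z1 N1]. destruct N2 as [z2 N2].
  apply imply_to_and in N1, N2. destruct N1 as [Q1 N1]. destruct N2 as [Q2 N2].
  set (b := fun i => z2 i - z1 i).
  assert (Hq : forall s, dyadic_cube n k m (line z1 b (clamp s))).
  { intros s i Hi. specialize (Q1 i Hi). specialize (Q2 i Hi).
    pose proof (clamp_range s). unfold line, b.
    set (lo := IZR (nth i m 0%Z) / 2 ^ k) in *.
    set (hi := (IZR (nth i m 0%Z) + 1) / 2 ^ k) in *. clearbody lo hi. nra. }
  destruct (IVT (fun s => y (line z1 b (clamp s))) 0 1) as [s [_ Hs]].
  - intros s eps He. destruct (Hy _ (proj1 (Hcube _ (Hq s))) eps He) as [d [Hd Hd']].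
    destruct (box_near n (line z1 b (clamp s)) b d Hd) as [d' [Hd1 Hd2]].
    exists d'. split; [exact Hd1|]. intros t [_ Ht]. apply Hd'; [apply Hcube, Hq|].
    apply (Hd2 (t - s)); [exact Ht|]. intros i Hi. unfold line.
    replace (z1 i + clamp t * b i - (z1 i + clamp s * b i)) with ((clamp t - clamp s) * b i)
      by ring.
    rewrite Rabs_mult. apply Rmult_le_compat_r; [apply Rabs_pos | apply clamp_lip].
  - lra.
  - replace (clamp 0) with 0 by (unfold clamp, Rmax, Rmin; repeat destruct Rle_dec; lra).
    rewrite line_0. destruct (Hcube z1 Q1) as [_ H]. unfold Rabs in H.
    destruct (Rcase_abs (y z1)); lra.
  - replace (clamp 1) with 1 by (unfold clamp, Rmax, Rmin; repeat destruct Rle_dec; lra).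
    replace (line z1 b 1) with z2.
    + destruct (Hcube z2 Q2) as [_ H]. unfold Rabs in H. destruct (Rcase_abs (y z2)); lra.
    + apply functional_extensionality. intros i. unfold line, b. ring.
  - destruct (Hcube _ (Hq s)) as [_ H]. simpl in Hs. rewrite Hs, Rabs_R0 in H. lra.
Qed.

Lemma normp_nonneg (n : nat) (G : Pt -> Prop) (p : pexp) (x : Pt -> R) : 0 <= normp n G p x.
Proof. destruct p; [apply rpow_nonneg|]. apply Rsup_nonneg. now left. Qed.

(* Since [y] is continuous and a dyadic cube is connected, on a cube where [|y|] is bounded
   below [y] keeps its sign, so only one of the two bounds on [y] matters there. This replaces
   the additivity of the integral. *)
Lemma normp_squeeze (n : nat) (G : Pt -> Prop) (p : pexp) : gbounded n G -> valid_p p ->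
  exists C, 0 < C /\ forall (y x1 x2 : Pt -> R) (k : R), cont_on n G y ->
    (exists B, forall z, G z -> Rabs (x1 z) <= B) ->
    (exists B, forall z, G z -> Rabs (x2 z) <= B) ->
    0 <= k ->
    (forall z, G z -> y z <= Rabs (x1 z) + k) ->
    (forall z, G z -> - y z <= Rabs (x2 z) + k) ->
    normp n G p y <= C * (normp n G p x1 + normp n G p x2 + k).
Proof.
  intros HG Hp. destruct p as [q|].
  - simpl in Hp. destruct (ginteg_split n G HG) as [V [HV Hsplit]].
    pose proof (rpow_nonneg V (/ q)) as HV'.
    (* Taking the root of the bound [HI] costs 2 for the outer sum, 2 for [I1 + I2] and 2 as the
       root of [rpow 2 q], which gives 8; the volume term keeps [2 * (2 * k)] times the root of
       [V]. *)
    exists (8 + 4 * rpow V (/ q)). split; [lra|].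
    intros y x1 x2 k Hy [B1 HB1] [B2 HB2] Hk H1 H2. cbn [normp].
    assert (Hq : 0 < / q <= 1).
    { split; [apply Rinv_0_lt_compat; lra|]. rewrite <- Rinv_1. apply Rinv_le_contravar; lra. }
    set (I1 := ginteg n G (fun z => rpow (Rabs (x1 z)) q)).
    set (I2 := ginteg n G (fun z => rpow (Rabs (x2 z)) q)).
    assert (HI : ginteg n G (fun z => rpow (Rabs (y z)) q) <=
      rpow 2 q * (I1 + I2) + rpow (2 * k) q * V).
    { apply (Hsplit _ _ _ _ _ (Rmax (rpow B1 q) (rpow B2 q)));
        [apply rpow_nonneg | apply rpow_nonneg | | |].
      - intros z Hz. apply Rle_trans with (2 := Rmax_l _ _). apply rpow_le; [lra|auto].
      - intros z Hz. apply Rle_trans with (2 := Rmax_r _ _). apply rpow_le; [lra|auto].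
      - intros j m c Hc Hcube. set (c' := rpow c (/ q)).
        assert (Ec : rpow c' q = c) by (apply rpow_inv_rpow; lra).
        assert (Hc' : forall z, dyadic_cube n j m z -> G z /\ c' <= Rabs (y z)).
        { intros z Hz. destruct (Hcube z Hz) as [HGz Hcz]. split; [exact HGz|].
          rewrite <- (rpow_rpow_inv (Rabs (y z)) q) by (lra || apply Rabs_pos).
          apply rpow_le; lra. }
        (* A low cube is charged to the error [rpow (2 * k) q]. On a high one [k < c' / 2], so [x1]
           or [x2], according to the sign of [y], is at least [c' / 2] in absolute value. *)
        destruct (Rle_lt_dec c' (2 * k)) as [Hle|Hgt].
        + exists 0, 0. repeat split; try lra; try apply rpow_nonneg.
          rewrite Rplus_0_l, Rmult_0_r, Rplus_0_l, <- Ec. apply rpow_le; lra.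
        + assert (Ec2 : c = rpow 2 q * rpow (c' / 2) q).
          { rewrite <- rpow_mult by lra. rewrite <- Ec at 1. f_equal. field. }
          pose proof (rpow_nonneg (c' / 2) q). pose proof (rpow_nonneg (2 * k) q).
          destruct (cube_constant_sign n G y j m c' Hy ltac:(lra) Hc') as [Hs|Hs].
          * exists (rpow (c' / 2) q), 0. repeat split; try lra; try apply rpow_nonneg.
            apply rpow_le; [lra|]. destruct (Hc' z H3) as [HGz _].
            specialize (Hs z H3). specialize (H1 z HGz). lra.
          * exists 0, (rpow (c' / 2) q). repeat split; try lra; try apply rpow_nonneg.
            apply rpow_le; [lra|]. destruct (Hc' z H3) as [HGz _].
            specialize (Hs z H3). specialize (H2 z HGz). lra. }
    assert (P1 : 0 <= I1) by apply ginteg_nonneg. assert (P2 : 0 <= I2) by apply ginteg_nonneg.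
    pose proof (rpow_nonneg 2 q). pose proof (rpow_nonneg (2 * k) q).
    apply (rpow_le _ _ (/ q) ltac:(lra)) in HI. apply Rle_trans with (1 := HI).
    eapply Rle_trans; [apply rpow_add_le; [lra | apply Rmult_le_pos; lra ..]|].
    rewrite (rpow_mult (rpow 2 q)), (rpow_mult (rpow (2 * k) q)), !rpow_rpow_inv by lra.
    pose proof (rpow_add_le I1 I2 (/ q) ltac:(lra) P1 P2).
    pose proof (rpow_nonneg I1 (/ q)). pose proof (rpow_nonneg I2 (/ q)).
    fold I1 I2. set (s1 := rpow I1 (/ q)) in *. set (s2 := rpow I2 (/ q)) in *.
    set (w := rpow V (/ q)) in *.
    assert (0 <= w * (s1 + s2)) by (apply Rmult_le_pos; lra).
    lra.
  - exists 1. split; [lra|]. intros y x1 x2 k Hy [B1 HB1] [B2 HB2] Hk H1 H2.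
    pose proof (normp_nonneg n G PInf x1) as P1. pose proof (normp_nonneg n G PInf x2) as P2.
    assert (Hub : forall x B, (forall z, G z -> Rabs (x z) <= B) ->
      forall z, G z -> Rabs (x z) <= normp n G PInf x).
    { intros x B HB z Hz. apply Rsup_ub with (b := Rmax 0 B).
      - intros s [->|[w [Hw ->]]]; [apply Rmax_l|]. apply Rle_trans with B; [auto|apply Rmax_r].
      - right. eauto. }
    rewrite Rmult_1_l. apply Rsup_le; [lra|]. intros s [->|[z [Hz ->]]]; [lra|].
    specialize (Hub x1 B1 HB1 z Hz) as U1. specialize (Hub x2 B2 HB2 z Hz) as U2.
    specialize (H1 z Hz). specialize (H2 z Hz).
    apply Rabs_le. lra.
Qed.

(** * Gains and barriers *)

Lemma K_inf_le (g : R -> R) (s t : R) : K_inf g -> 0 <= s -> s <= t -> g s <= g t.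
Proof.
  intros [_ [_ [Hm _]]] Hs Hst. destruct (Rle_lt_or_eq_dec s t Hst) as [H|<-]; [|lra].
  left. now apply Hm.
Qed.

Lemma K_inf_affine (g : R -> R) (al be : R) : K_inf g -> 0 < al -> 0 < be ->
  K_inf (fun s => al * s + be * g s).
Proof.
  intros Hg Hal Hbe. assert (Hg' := Hg). destruct Hg' as [H0 [Hc [Hm Hu]]].
  split; [rewrite H0; ring|]. split; [|split].
  - intros t Ht eps He.
    destruct (Hc t Ht (eps / 2 / be)) as [d [Hd Hd']].
    { repeat apply Rdiv_lt_0_compat; lra. }
    exists (Rmin d (eps / 2 / al)). split.
    { apply Rmin_pos; [exact Hd|]. repeat apply Rdiv_lt_0_compat; lra. }
    intros s Hs Hst.
    specialize (Hd' s Hs (Rlt_le_trans _ _ _ Hst (Rmin_l _ _))).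
    pose proof (Rlt_le_trans _ _ _ Hst (Rmin_r _ _)) as Hst'.
    apply Rmult_lt_compat_l with (r := be) in Hd'; [|exact Hbe].
    apply Rmult_lt_compat_l with (r := al) in Hst'; [|exact Hal].
    replace (be * (eps / 2 / be)) with (eps / 2) in Hd' by (field; lra).
    replace (al * (eps / 2 / al)) with (eps / 2) in Hst' by (field; lra).
    replace (al * s + be * g s - (al * t + be * g t))
      with (al * (s - t) + be * (g s - g t)) by ring.
    apply Rle_lt_trans with (1 := Rabs_triang _ _).
    rewrite !Rabs_mult, (Rabs_right al), (Rabs_right be) by lra. lra.
  - intros s t Hs Hst. specialize (Hm s t Hs Hst). nra.
  - intros B. destruct (Hu (B / be)) as [t [Ht HB]]. exists t. split; [exact Ht|].
    apply Rmult_lt_compat_l with (r := be) in HB; [|exact Hbe].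
    replace (be * (B / be)) with B in HB by (field; lra). nra.
Qed.

Lemma K_inf_le_right_limit (g : R -> R) (q c r : R) : K_inf g -> 0 <= r ->
  (forall eps, 0 < eps -> q <= c + g (r + eps)) -> q <= c + g r.
Proof.
  intros [_ [Hc _]] Hr H. apply Rnot_lt_le. intros Hlt.
  destruct (Hc r Hr (q - c - g r) ltac:(lra)) as [d [Hd Hd']].
  specialize (H (d / 2) ltac:(lra)).
  specialize (Hd' (r + d / 2) ltac:(lra)). replace (r + d / 2 - r) with (d / 2) in Hd' by ring.
  rewrite (Rabs_right (d / 2)) in Hd' by lra. specialize (Hd' ltac:(lra)).
  apply Rabs_def2 in Hd'. lra.
Qed.

Lemma normU_bound (n : nat) (G : Pt -> Prop) (u : R -> Pt -> R) : U_set n G u ->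
  0 <= normU n G u /\ forall t z, 0 <= t -> bdry n G z -> Rabs (u t z) <= normU n G u.
Proof.
  intros [_ [_ [B HB]]]. split; [apply Rsup_nonneg; now left|].
  intros t z Ht Hz. apply Rsup_ub with (b := Rmax 0 B); [|right; eauto].
  intros s [->|[t' [z' [Ht' [Hz' ->]]]]]; [apply Rmax_l|].
  apply Rle_trans with B; [auto | apply Rmax_r].
Qed.

(** Only an inequality: over an empty boundary the norm is 0. *)
Lemma normU_const_le (n : nat) (G : Pt -> Prop) (k : R) : normU n G (fun _ _ => k) <= Rabs k.
Proof.
  apply Rsup_le; [apply Rabs_pos|]. intros s [->|[t [z [_ [_ ->]]]]]; [apply Rabs_pos | lra].
Qed.

Lemma U_set_const (n : nat) (G : Pt -> Prop) (k : R) : U_set n G (fun _ _ => k).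
Proof.
  split; [intros; apply cont_on_const|]. split.
  - intros t Ht eps He. exists 1. split; [lra|]. intros. now rewrite Rminus_diag, Rabs_R0.
  - exists (Rabs k). intros; lra.
Qed.

Lemma is_sol_cont_on (n : nat) (G : Pt -> Prop) (A : nat -> nat -> Pt -> R)
  (f : Pt -> R -> Pt -> R) (x0 : Pt -> R) (u x : R -> Pt -> R) (t : R) :
  is_sol n G A f x0 u x -> 0 <= t -> cont_on n (clos n G) (x t).
Proof. intros [Hx _] Ht. revert Hx. apply cont2_on_slice. now split. Qed.

Lemma cont_on_clos_bounded_shift (n : nat) (G : Pt -> Prop) (g : Pt -> R) (c : R) :
  gbounded n G -> cont_on n (clos n G) g -> exists B, forall z, G z -> Rabs (g z - c) <= B.
Proof.
  intros HG Hg. destruct (cont_on_bounded n G (fun z => g z - c) HG) as [B HB].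
  - now apply cont_on_shift.
  - exists B. intros z Hz. now apply HB, clos_sub.
Qed.

(** The barrier is the convex combination of [x0] and [r + eps] given by (H3). Within [delta] of the
    boundary [x0] is at most [r + eps], so the combination lies above it; elsewhere [k = 0] and the
    two coincide. Its distance to [r + eps] is that of [x0] multiplied by [1 - k]. *)
Lemma upper_barrier (n : nat) (G : Pt -> Prop) (X : (Pt -> R) -> Prop) (x0 : Pt -> R) (r eps : R) :
  gopen n G -> gbounded n G -> cont_on n (clos n G) x0 ->
  (forall delta a, 0 < delta -> exists k : Pt -> R,
    (forall z, clos n G z -> 0 <= k z <= 1) /\ (forall z, bdry n G z -> k z = 1) /\
    (forall z, G z -> (forall s, bdry n G s -> delta <= dst n z s) -> k z = 0) /\
    X (fun z => (1 - k z) * x0 z + a * k z)) ->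
  (forall z, bdry n G z -> x0 z <= r) -> 0 < eps ->
  exists x0', X x0' /\ (forall z, bdry n G z -> x0' z = r + eps) /\
    forall z, G z -> x0 z <= x0' z /\ Rabs (x0' z - (r + eps)) <= Rabs (x0 z - (r + eps)).
Proof.
  intros HGo HG Hx0 HX Hr He.
  destruct (near_bdry_le n G x0 r eps HGo HG Hx0 Hr He) as [delta [Hdelta Hnear]].
  destruct (HX delta (r + eps) Hdelta) as [k [Hk01 [Hk1 [Hk0 HXk]]]].
  exists (fun z => (1 - k z) * x0 z + (r + eps) * k z). split; [exact HXk|]. split.
  - intros z Hz. rewrite Hk1 by exact Hz. ring.
  - intros z Hz. specialize (Hk01 z (clos_sub n G z Hz)). split.
    + destruct (classic (exists s, bdry n G s /\ dst n z s < delta)) as [[s [Hs Hd]]|Hno].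
      * specialize (Hnear z s Hz Hs Hd). nra.
      * rewrite Hk0; [lra|exact Hz|]. intros s Hs. apply Rnot_lt_le. intros Hd.
        apply Hno. now exists s.
    + replace ((1 - k z) * x0 z + (r + eps) * k z - (r + eps))
        with ((1 - k z) * (x0 z - (r + eps))) by ring.
      rewrite Rabs_mult, (Rabs_right (1 - k z)) by lra.
      pose proof (Rabs_pos (x0 z - (r + eps))). nra.
Qed.

(** Both nontrivial implications squeeze twice around the assumed estimate: the initial state costs
    [C * (2 * N + b)], the final state another [C]. Bounding [E] by 1 in front of [b] moves the
    shift of the initial state into the gain. *)
Lemma iss_constants (C M E N b q : R) : 0 < C -> 0 < M -> 0 <= E <= 1 -> 0 <= b ->
  C * (2 * (M * E * (C * (2 * N + b)) + q) + b) <=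
  4 * M * C * C * E * N + ((2 * M * C * C + C) * b + 2 * C * q).
Proof.
  intros HC HM HE Hb.
  assert (0 <= 2 * (M * (C * C)) * (b * (1 - E))).
  { repeat apply Rmult_le_pos; lra. }
  lra.
Qed.

(** * Equivalence of the three stability estimates *)

Theorem mainTheorem6
  (n : nat) (G : Pt -> Prop) (A : nat -> nat -> Pt -> R)
  (f : Pt -> R -> Pt -> R)
  (X : (Pt -> R) -> Prop) (Uad : (Pt -> R) -> (R -> Pt -> R) -> Prop)
  (p : pexp)
  (* standing setting *)
  (HGo : gopen n G) (HGb : gbounded n G)
  (HA : forall i j, (i < n)%nat -> (j < n)%nat -> cont_on n (clos n G) (A i j))
  (Hf : cont_f n G f)
  (Hpar : exists K, 0 < K /\ forall z xi, clos n G z ->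
     sumR n (fun i => sumR n (fun j => A i j z * xi i * xi j))
       >= K * sumR n (fun i => xi i ^ 2))
  (* (H1) *)
  (HXc : forall x, X x -> cont_on n (clos n G) x)
  (HXadd : forall x y, X x -> X y -> X (fun z => x z + y z))
  (HXscal : forall c x, X x -> X (fun z => c * x z))
  (HXconst : forall c, X (fun _ => c))
  (HXext : forall x y, X x -> (forall z, clos n G z -> x z = y z) -> X y)
  (HUne : forall x0, X x0 -> exists u, Uad x0 u)
  (HUsub : forall x0 u, X x0 -> Uad x0 u ->
     U_set n G u /\ forall z, bdry n G z -> u 0 z = x0 z)
  (HUconst : forall x0 v, X x0 -> U_set n G v ->
     (forall t z, 0 <= t -> bdry n G z -> v t z = x0 z) -> Uad x0 v)
  (HUext : forall x0 x0' u u', X x0 -> Uad x0 u ->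
     (forall z, clos n G z -> x0 z = x0' z) ->
     (forall t z, 0 <= t -> bdry n G z -> u t z = u' t z) -> Uad x0' u')
  (HUsol : forall x0 u, X x0 -> Uad x0 u ->
     exists x, is_sol n G A f x0 u x /\ forall t, 0 <= t -> X (x t))
  (* (H2) *)
  (HH2a : forall W : R -> Prop, (exists B, forall w, W w -> Rabs w <= B) ->
     exists k, 0 < k /\ forall w1 w2 z xi, W w1 -> W w2 -> w2 < w1 -> G z ->
       f z w1 xi - f z w2 xi < k * (w1 - w2))
  (HH2b : exists (fw : Pt -> R -> Pt -> R) (fxi : nat -> Pt -> R -> Pt -> R),
     (forall z w xi, clos n G z ->
        derivable_pt_lim (fun s => f z s xi) w (fw z w xi)) /\
     (forall i z w xi, (i < n)%nat -> clos n G z ->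
        derivable_pt_lim (fun h => f z w (upd xi i h)) (xi i) (fxi i z w xi)) /\
     cont_f n G fw /\ (forall i, (i < n)%nat -> cont_f n G (fxi i)))
  (* (H3) *)
  (HH3 : forall delta a x, 0 < delta -> X x ->
     exists k : Pt -> R,
       cont_on n (clos n G) k /\
       (forall z, clos n G z -> 0 <= k z <= 1) /\
       (forall z, bdry n G z -> k z = 1) /\
       (forall z, G z -> (forall s, bdry n G s -> delta <= dst n z s) -> k z = 0) /\
       X (fun z => (1 - k z) * x z + a * k z))
  (Hp : valid_p p) :
  let ISS_P := exists M a g, 0 < M /\ 0 < a /\ K_inf g /\
     forall t x0 u x, 0 <= t -> X x0 -> Uad x0 u -> is_sol n G A f x0 u x ->
       normp n G p (x t) <= M * exp (- a * t) * normp n G p x0 + g (normU n G u) in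
  let ISS_Pconst := exists M a g, 0 < M /\ 0 < a /\ K_inf g /\
     forall t x0 u x, 0 <= t -> X x0 -> Uad x0 u ->
       (forall s z, 0 <= s -> bdry n G z -> u s z = u 0 z) ->
       is_sol n G A f x0 u x ->
       normp n G p (x t) <= M * exp (- a * t) * normp n G p x0 + g (normU n G u) in
  let ISS_Q := exists M a g, 0 < M /\ 0 < a /\ K_inf g /\
     forall t y (k : R) x, 0 <= t -> X y -> (forall z, bdry n G z -> y z = 0) ->
       is_sol n G A f (fun z => y z + k) (fun _ _ => k) x ->
       normp n G p (fun z => x t z - k) <= M * exp (- a * t) * normp n G p y + g (Rabs k) in
  (ISS_P <-> ISS_Pconst) /\ (ISS_Pconst <-> ISS_Q).
Proof.
  intros ISS_P ISS_Pconst ISS_Q.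
  destruct (normp_squeeze n G p HGb Hp) as [C [HC Hsq]].
  assert (Hexp : forall a t, 0 < a -> 0 <= t -> 0 <= exp (- a * t) <= 1).
  { intros a t Ha Ht. split; [left; apply exp_pos|]. rewrite <- exp_0.
    destruct (Rle_lt_or_eq_dec 0 t Ht) as [H|<-]; [left; apply exp_increasing; nra|].
    right. f_equal. ring. }
  assert (HPPc : ISS_P -> ISS_Pconst).
  { intros [M [a [g [HM [Ha [Hg H]]]]]]. exists M, a, g.
    repeat (split; [assumption|]). intros; now apply H with (u := u). }
  (* As [y] vanishes on the boundary, the constant input [k] is admissible for [y + k]; the shift by
     [k] is squeezed out of the initial and of the final state. *)
  assert (HPcQ : ISS_Pconst -> ISS_Q).
  { intros [M [a [g [HM [Ha [Hg H]]]]]].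
    exists (4 * M * C * C), a, (fun s => (2 * M * C * C + C) * s + 2 * C * g s).
    split; [repeat apply Rmult_lt_0_compat; lra|]. split; [exact Ha|].
    assert (0 < M * C * C) by (repeat apply Rmult_lt_0_compat; lra).
    split; [apply K_inf_affine; [exact Hg | lra | lra]|].
    intros t y k x Ht Hy Hy0 Hx. pose proof (Rabs_pos k) as Hk.
    assert (HX : X (fun z => y z + k)) by (apply (HXadd y (fun _ => k)); auto).
    specialize (H t _ (fun _ _ => k) x Ht HX).
    assert (Had : Uad (fun z => y z + k) (fun _ _ => k)).
    { apply HUconst; [exact HX | apply U_set_const|]. intros s z _ Hz. rewrite Hy0; [ring|exact Hz]. }
    specialize (H Had ltac:(reflexivity) Hx).
    pose proof (is_sol_cont_on n G A f _ _ x t Hx Ht) as Hxt.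
    assert (Hgk : g (normU n G (fun _ _ => k)) <= g (Rabs k)).
    { apply K_inf_le; [exact Hg | apply normU_bound, U_set_const | apply normU_const_le]. }
    assert (N1 : normp n G p (fun z => x t z - k) <=
      C * (normp n G p (x t) + normp n G p (x t) + Rabs k)).
    { destruct (cont_on_clos_bounded_shift n G (x t) 0 HGb Hxt) as [B HB].
      assert (exists B, forall z, G z -> Rabs (x t z) <= B).
      { exists B. intros z Hz. specialize (HB z Hz). now rewrite Rminus_0_r in HB. }
      apply Hsq; try assumption.
      - apply cont_on_shift. revert Hxt. apply cont_on_sub, clos_sub.
      - intros z _. unfold Rabs; repeat destruct Rcase_abs; lra.
      - intros z _. unfold Rabs; repeat destruct Rcase_abs; lra. }
    assert (N2 : normp n G p (fun z => y z + k) <=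
      C * (normp n G p y + normp n G p y + Rabs k)).
    { destruct (cont_on_clos_bounded_shift n G y 0 HGb (HXc y Hy)) as [B HB].
      assert (exists B, forall z, G z -> Rabs (y z) <= B).
      { exists B. intros z Hz. specialize (HB z Hz). now rewrite Rminus_0_r in HB. }
      apply Hsq; try assumption.
      - apply (cont_on_sub n _ G _ (clos_sub n G)), HXc, HX.
      - intros z _. unfold Rabs; repeat destruct Rcase_abs; lra.
      - intros z _. unfold Rabs; repeat destruct Rcase_abs; lra. }
    pose proof (Hexp a t Ha Ht) as HE.
    apply Rle_trans with (2 := iss_constants C M _ _ _ _ HC HM HE Hk).
    apply Rle_trans with (1 := N1). apply Rmult_le_compat_l; [lra|].
    assert (M * exp (- a * t) * normp n G p (fun z => y z + k) <=
      M * exp (- a * t) * (C * (2 * normp n G p y + Rabs k))).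
    { apply Rmult_le_compat_l; [apply Rmult_le_pos; lra | lra]. }
    lra. }
  assert (HQP : ISS_Q -> ISS_P).
  { intros [M [a [g [HM [Ha [Hg H]]]]]].
    exists (4 * M * C * C), a, (fun s => (2 * M * C * C + C) * s + 2 * C * g s).
    split; [repeat apply Rmult_lt_0_compat; lra|]. split; [exact Ha|].
    assert (0 < M * C * C) by (repeat apply Rmult_lt_0_compat; lra).
    assert (Hh : K_inf (fun s => (2 * M * C * C + C) * s + 2 * C * g s)).
    { apply K_inf_affine; [exact Hg | lra | lra]. }
    split; [exact Hh|].
    intros t x0 u x Ht Hx0 Hu Hx. destruct (HUsub x0 u Hx0 Hu) as [HU Hu0].
    destruct (normU_bound n G u HU) as [Hr Hur]. set (r := normU n G u) in *.
    (* The estimate is proved with gain at [r + eps] for each [eps]; [M] and the gain do not depend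
       on [eps]. *)
    apply (K_inf_le_right_limit _ _ _ r Hh Hr). intros eps Heps.
    set (b := r + eps). assert (Hb : 0 < b) by (unfold b; lra).
    assert (Hbd : exists B, forall z, G z -> Rabs (x0 z) <= B).
    { destruct (cont_on_clos_bounded_shift n G x0 0 HGb (HXc x0 Hx0)) as [B HB].
      exists B. intros z Hz. specialize (HB z Hz). now rewrite Rminus_0_r in HB. }
    (* Serves both barriers, with [c] equal to [b] or [- b]: subtracting [c] from [y0] gives a state
       that vanishes on the boundary, to which the estimate for (Q) applies. *)
    assert (Hbar : forall y0 c, X y0 -> Rabs c = b -> (forall z, bdry n G z -> y0 z = c) ->
      (forall z, G z -> Rabs (y0 z - c) <= Rabs (x0 z - c)) ->
      exists y, is_sol n G A f y0 (fun _ _ => c) y /\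
        normp n G p (fun z => y t z - c) <=
        M * exp (- a * t) * (C * (2 * normp n G p x0 + b)) + g b).
    { intros y0 c Hy0 Hc Hyb Hyx.
      assert (Had : Uad y0 (fun _ _ => c)).
      { apply HUconst; [exact Hy0 | apply U_set_const|]. intros s z _ Hz. now rewrite Hyb. }
      destruct (HUsol y0 _ Hy0 Had) as [y [Hy _]]. exists y. split; [exact Hy|].
      assert (HY : X (fun z => y0 z + - c)) by (apply (HXadd y0 (fun _ => - c)); auto).
      specialize (H t (fun z => y0 z + - c) c y Ht HY).
      rewrite Hc in H. eapply Rle_trans; [apply H|].
      - intros z Hz. rewrite Hyb by exact Hz. ring.
      - replace (fun z => y0 z + - c + c) with y0; [exact Hy|].
        apply functional_extensionality. intros; ring.
      - apply Rplus_le_compat_r, Rmult_le_compat_l.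
        + apply Rmult_le_pos; [lra | apply Hexp; assumption].
        + replace (2 * normp n G p x0 + b) with (normp n G p x0 + normp n G p x0 + b) by ring.
          apply Hsq; try assumption; try lra.
          * apply (cont_on_sub n _ G _ (clos_sub n G)), HXc, HY.
          * intros z Hz. specialize (Hyx z Hz). rewrite <- Hc. revert Hyx.
            unfold Rabs; repeat destruct Rcase_abs; lra.
          * intros z Hz. specialize (Hyx z Hz). rewrite <- Hc. revert Hyx.
            unfold Rabs; repeat destruct Rcase_abs; lra. }
    assert (Hx0r : forall z, bdry n G z -> - r <= x0 z <= r).
    { intros z Hz. specialize (Hur 0 z (Rle_refl 0) Hz). rewrite Hu0 in Hur by exact Hz.
      revert Hur. unfold Rabs; destruct Rcase_abs; lra. }
    assert (HH3' : forall x, X x -> forall delta c, 0 < delta -> exists k : Pt -> R,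
      (forall z, clos n G z -> 0 <= k z <= 1) /\ (forall z, bdry n G z -> k z = 1) /\
      (forall z, G z -> (forall s, bdry n G s -> delta <= dst n z s) -> k z = 0) /\
      X (fun z => (1 - k z) * x z + c * k z)).
    { intros y Hy delta c Hdelta. destruct (HH3 delta c y Hdelta Hy) as [k [_ Hk]].
      now exists k. }
    (* The lower barrier is the negative of an upper barrier for [- x0], which has the same bound
       [r] on the boundary. *)
    assert (Hnx0 : X (fun z => -1 * x0 z)) by now apply HXscal.
    destruct (upper_barrier n G X x0 r eps HGo HGb (HXc x0 Hx0) (HH3' _ Hx0))
      as [yp [Xp [Bp Gp]]]; [apply Hx0r | exact Heps|].
    destruct (upper_barrier n G X (fun z => -1 * x0 z) r eps HGo HGb (HXc _ Hnx0) (HH3' _ Hnx0))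
      as [ym [Xm [Bm Gm]]]; [intros z Hz; specialize (Hx0r z Hz); lra | exact Heps|].
    fold b in Bp, Gp, Bm, Gm.
    destruct (Hbar yp b Xp) as [xp [Sp Np]].
    { apply Rabs_right; lra. }
    { exact Bp. }
    { intros z Hz. now apply Gp. }
    destruct (Hbar (fun z => -1 * ym z) (- b)) as [xm [Sm Nm]].
    { now apply HXscal. }
    { rewrite Rabs_Ropp. apply Rabs_right; lra. }
    { intros z Hz. rewrite Bm by exact Hz. ring. }
    { intros z Hz. destruct (Gm z Hz) as [_ H1].
      replace (-1 * ym z - - b) with (- (ym z - b)) by ring.
      replace (x0 z - - b) with (- (-1 * x0 z - b)) by ring. now rewrite !Rabs_Ropp. }
    assert (Cp : forall z, G z -> x t z <= xp t z).
    { intros z Hz.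
      apply (comparison_principle n G A f x0 yp u (fun _ _ => b) x xp); try assumption.
      - intros w Hw. now apply Gp.
      - intros s w Hs Hw. specialize (Hur s w Hs Hw). revert Hur.
        unfold b, Rabs; destruct Rcase_abs; lra.
      - now apply clos_sub. }
    assert (Cm : forall z, G z -> xm t z <= x t z).
    { intros z Hz.
      apply (comparison_principle n G A f (fun z => -1 * ym z) x0 (fun _ _ => - b) u xm x); try assumption.
      - intros w Hw. destruct (Gm w Hw). lra.
      - intros s w Hs Hw. specialize (Hur s w Hs Hw). revert Hur.
        unfold b, Rabs; destruct Rcase_abs; lra.
      - now apply clos_sub. }
    apply Rle_trans with (2 := iss_constants C M _ _ b (g b) HC HM (Hexp a t Ha Ht) ltac:(lra)).
    (* From [xm <= x <= xp] follow [x <= Rabs (xp - b) + b] and [- x <= Rabs (xm + b) + b], the two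
       one-sided bounds that the squeeze requires. *)
    apply Rle_trans with (C * (normp n G p (fun z => xp t z - b) +
      normp n G p (fun z => xm t z - - b) + b)).
    - apply Hsq; [| | |lra| |].
      + apply (cont_on_sub n _ G _ (clos_sub n G)). now apply (is_sol_cont_on n G A f x0 u).
      + apply (cont_on_clos_bounded_shift n); [exact HGb|].
        now apply (is_sol_cont_on n G A f _ _ _ _ Sp).
      + apply (cont_on_clos_bounded_shift n); [exact HGb|].
        now apply (is_sol_cont_on n G A f _ _ _ _ Sm).
      + intros z Hz. specialize (Cp z Hz). pose proof (Rle_abs (xp t z - b)). lra.
      + intros z Hz. specialize (Cm z Hz). pose proof (Rle_abs (- (xm t z - - b))).
        rewrite Rabs_Ropp in H1. lra.
    - apply Rmult_le_compat_l; lra. }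
  split; split; auto.
Qed.
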